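(* Every subgroup of $PSL_2(\mathbb{C})$ is either virtually solvable or MIF (mixed identity free).
   Context: Let $F_n$ be the free group of rank $n$. A group $G$ satisfies a mixed identity $w=1$, $w\in G*F_n$, if every homomorphism $G*F_n\to G$ that is the identity on $G$ sends $w$ to $1$. The mixed identity is non-trivial if $w\neq 1$ in $G*F_n$. $G$ is MIF if it satisfies no non-trivial mixed identity (for any $n$). A group is virtually solvable if it has a solvable subgroup of finite index. *)

(* Defs.v *)
From HB Require Import structures.
From mathcomp Require Import all_boot all_order all_algebra.
From mathcomp Require Import generic_quotient.
From mathcomp Require Import boolp classical_sets cardinality reals complex.

Set Implicit Arguments.
Unset Strict Implicit.
Unset Printing Implicit Defensive.

Import GRing.Theory.

Local Open Scope classical_set_scope.
Local Open Scope quotient_scope.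
Local Open Scope group_scope.

(* the letter (x, false) stands for x and (x, true) for x^-1 *)

Notation word X := (seq (X * bool)).

Section Presentation.
Variables (X : choiceType) (R : word X -> word X -> Prop).

Definition letter_inv (l : X * bool) : X * bool := (l.1, ~~ l.2).
Definition word_inv (u : word X) : word X := rev (map letter_inv u).

Inductive pres_cong : word X -> word X -> Prop :=
| pres_cong_refl u : pres_cong u u
| pres_cong_sym u v : pres_cong u v -> pres_cong v u
| pres_cong_trans u v w : pres_cong u v -> pres_cong v w -> pres_cong u w
| pres_cong_cat u u' v v' :
    pres_cong u u' -> pres_cong v v' -> pres_cong (u ++ v) (u' ++ v')
| pres_cong_cancel l : pres_cong [:: l; letter_inv l] [::]
| pres_cong_rel u v : R u v -> pres_cong u v.

Definition pres_congb : rel (word X) := fun u v => `[< pres_cong u v >].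

Lemma pres_congb_equiv : equiv_class_of pres_congb.
Proof.
split=> [u|u v|u v w].
- exact/asboolP/pres_cong_refl.
- by apply/asboolP/asboolP; exact: pres_cong_sym.
- move=> /asboolP uv /asboolP vw; apply/asboolP; exact: pres_cong_trans uv vw.
Qed.

Canonical pres_congb_equiv_rel := EquivRelPack pres_congb_equiv.

Definition presented := {eq_quot pres_congb}.

HB.instance Definition _ := Choice.on presented.
HB.instance Definition _ := EqQuotient.on presented.

Implicit Types (p q : presented) (u v : word X).

Lemma presented_eqP u v :
  reflect (pres_cong u v) (\pi_presented u == \pi_presented v).
Proof. by rewrite eqmodE; apply: asboolP. Qed.

Lemma pi_presentedP u v :
  \pi_presented u = \pi_presented v <-> pres_cong u v.
Proof. by split=> [/eqP/presented_eqP//|?]; apply/eqP/presented_eqP. Qed.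

Lemma pres_cong_repr u : pres_cong (repr (\pi_presented u)) u.
Proof. by apply/pi_presentedP; rewrite reprK. Qed.

Lemma letter_invK : involutive letter_inv.
Proof. by case=> x b; rewrite /letter_inv /= negbK. Qed.

Lemma word_invK : involutive word_inv.
Proof.
by move=> u; rewrite /word_inv map_rev revK mapK //; exact: letter_invK.
Qed.

Lemma pres_cong_mulV u : pres_cong (u ++ word_inv u) [::].
Proof.
elim: u => [|l u IH]; first exact: pres_cong_refl.
rewrite /word_inv /= rev_cons -cats1 catA -cat1s -[l :: _]cat1s.
apply: pres_cong_trans (pres_cong_cancel l).
rewrite -catA -[[:: l; letter_inv l]]/([:: l] ++ ([::] ++ [:: letter_inv l])).
apply: pres_cong_cat (pres_cong_refl _) _.
exact: pres_cong_cat IH (pres_cong_refl _).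
Qed.

Lemma pres_cong_Vmul u : pres_cong (word_inv u ++ u) [::].
Proof. by rewrite -{2}(word_invK u); apply: pres_cong_mulV. Qed.

Lemma pres_cong_inv u v : pres_cong u v -> pres_cong (word_inv u) (word_inv v).
Proof.
move=> uv; apply: (@pres_cong_trans _ (word_inv u ++ (v ++ word_inv v))).
  rewrite -{1}[word_inv u]cats0; apply: pres_cong_cat (pres_cong_refl _) _.
  exact/pres_cong_sym/pres_cong_mulV.
rewrite catA -[X in pres_cong _ X]cat0s.
apply: pres_cong_cat _ (pres_cong_refl _).
apply: pres_cong_trans (pres_cong_Vmul u).
exact: pres_cong_cat (pres_cong_refl _) (pres_cong_sym uv).
Qed.

Definition pres_mul p q := \pi_presented (repr p ++ repr q).
Definition pres_one := \pi_presented [::].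
Definition pres_inv p := \pi_presented (word_inv (repr p)).

Lemma pres_mulE u v :
  pres_mul (\pi u) (\pi v) = \pi_presented (u ++ v).
Proof. by apply/pi_presentedP/pres_cong_cat; exact: pres_cong_repr. Qed.

Lemma pres_invE u : pres_inv (\pi u) = \pi_presented (word_inv u).
Proof. by apply/pi_presentedP/pres_cong_inv/pres_cong_repr. Qed.

Lemma pres_mulA : associative pres_mul.
Proof.
move=> p q r; rewrite -[p]reprK -[q]reprK -[r]reprK.
by rewrite !pres_mulE catA.
Qed.

Lemma pres_mul1 : left_id pres_one pres_mul.
Proof. by move=> p; rewrite -[p]reprK pres_mulE. Qed.

Lemma pres_1mul : right_id pres_one pres_mul.
Proof. by move=> p; rewrite -[p]reprK pres_mulE cats0. Qed.

Lemma pres_mulV : right_inverse pres_one pres_inv pres_mul.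
Proof.
move=> p; rewrite -[p]reprK pres_invE pres_mulE.
exact/pi_presentedP/pres_cong_mulV.
Qed.

Lemma pres_Vmul : left_inverse pres_one pres_inv pres_mul.
Proof.
move=> p; rewrite -[p]reprK pres_invE pres_mulE.
exact/pi_presentedP/pres_cong_Vmul.
Qed.

HB.instance Definition _ := isGroup.Build presented
  pres_mulA pres_mul1 pres_1mul pres_Vmul pres_mulV.

Definition pres_gen (x : X) : presented := \pi_presented [:: (x, false)].

End Presentation.

Definition word_eval (X : choiceType) (K : groupType) (f : X -> K)
    (u : word X) : K :=
  \prod_(l <- u) (if l.2 then (f l.1)^-1 else f l.1).

Section PresentationTheory.
Variables (X : choiceType) (R : word X -> word X -> Prop) (K : groupType).

Lemma pres_gen_word (u : word X) :
  \pi_(presented R) u = word_eval (@pres_gen X R) u.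
Proof.
rewrite /word_eval; elim: u => [|[x b] u IH]; first by rewrite big_nil.
rewrite big_cons -IH /= -cat1s -(pres_mulE R [:: (x, b)] u).
by congr (_ * _); case: b => //; rewrite -[RHS]/(pres_inv _) pres_invE.
Qed.

Lemma pres_morph_word (phi : UMagmaMorphism.type (presented R) K)
    (u : word X) :
  phi (\pi u) = word_eval (phi \o @pres_gen X R) u.
Proof.
rewrite pres_gen_word /word_eval gmulf_prod; apply: eq_bigr => -[x []] _ //=.
exact: gmulfV.
Qed.

Lemma pres_morph_ext (phi psi : UMagmaMorphism.type (presented R) K) :
  (forall x, phi (pres_gen R x) = psi (pres_gen R x)) -> phi =1 psi.
Proof.
move=> e p; rewrite -[p]reprK !pres_morph_word /word_eval.
by apply: eq_bigr => l _ /=; rewrite e.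
Qed.

Section Lift.
Variable f : X -> K.
Hypothesis fR : forall u v, R u v -> word_eval f u = word_eval f v.

Lemma word_eval_cong u v : pres_cong R u v -> word_eval f u = word_eval f v.
Proof.
elim=> {u v} [//|u v _ -> //|u v w _ -> _ -> //|u u' v v' _ e1 _ e2||//].
- by rewrite /word_eval !big_cat /=; congr (_ * _).
- move=> [x b]; rewrite /word_eval !big_cons !big_nil mulg1 /=.
  by case: b; rewrite ?mulgV ?mulVg.
Qed.

Lemma pres_lift_exists : exists phi : UMagmaMorphism.type (presented R) K,
  forall x, phi (pres_gen R x) = f x.
Proof.
pose phi (p : presented R) := word_eval f (repr p).
have phiE u : phi (\pi u) = word_eval f u.
  by apply: word_eval_cong; exact: pres_cong_repr.
have phiM : {morph phi : p q / p * q}.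
  move=> p q; rewrite -[p]reprK -[q]reprK.
  by rewrite -[_ * _]/(pres_mul _ _) pres_mulE !phiE /word_eval big_cat.
have phi1 : phi 1 = 1 by rewrite -[1]/(pres_one R) phiE /word_eval big_nil.
pose m := isUMagmaMorphism.Build (presented R) K phi (phi1, phiM).
pose h : UMagmaMorphism.type (presented R) K := HB.pack phi m.
by exists h => x; rewrite /= phiE /word_eval big_seq1.
Qed.

End Lift.
End PresentationTheory.

Definition no_rel (X : choiceType) (u v : word X) : Prop := False.

Definition free_group (X : choiceType) := presented (@no_rel X).
HB.instance Definition _ (X : choiceType) := Group.on (free_group X).

Definition free_gen (X : choiceType) : X -> free_group X :=
  @pres_gen X (@no_rel X).

Lemma free_group_universal (X : choiceType) (K : groupType) (f : X -> K) :
  (exists phi : UMagmaMorphism.type (free_group X) K,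
    forall x, phi (free_gen x) = f x) /\
  (forall phi psi : UMagmaMorphism.type (free_group X) K,
    (forall x, phi (free_gen x) = psi (free_gen x)) -> phi =1 psi).
Proof.
by split; [apply: pres_lift_exists | move=> phi psi; apply: pres_morph_ext].
Qed.

(* The relations are the two multiplication tables; that inl 1, inr 1 are     *)
(* trivial and that inl, inr commute with inverses follows.                   *)

Section FreeProduct.
Variables G H : groupType.

Inductive free_prod_rel : word (G + H)%type -> word (G + H)%type -> Prop :=
| free_prod_rel_l (a b : G) : free_prod_rel
    [:: (inl a, false); (inl b, false)] [:: (inl (a * b), false)]
| free_prod_rel_r (a b : H) : free_prod_rel
    [:: (inr a, false); (inr b, false)] [:: (inr (a * b), false)].

Definition free_prod := presented free_prod_rel.
HB.instance Definition _ := Group.on free_prod.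

Definition free_prod_inl (a : G) : free_prod := pres_gen free_prod_rel (inl a).
Definition free_prod_inr (b : H) : free_prod := pres_gen free_prod_rel (inr b).

Lemma free_prod_inlM : {morph free_prod_inl : a b / a * b}.
Proof.
move=> a b; rewrite -[RHS]/(pres_mul _ _) pres_mulE.
by apply/pi_presentedP/pres_cong_sym/pres_cong_rel; left.
Qed.

Lemma free_prod_inrM : {morph free_prod_inr : a b / a * b}.
Proof.
move=> a b; rewrite -[RHS]/(pres_mul _ _) pres_mulE.
by apply/pi_presentedP/pres_cong_sym/pres_cong_rel; right.
Qed.

Lemma free_prod_universal (K : groupType)
    (f : UMagmaMorphism.type G K) (g : UMagmaMorphism.type H K) :
  (exists phi : UMagmaMorphism.type free_prod K,
    (forall a, phi (free_prod_inl a) = f a) /\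
    (forall b, phi (free_prod_inr b) = g b)) /\
  (forall phi psi : UMagmaMorphism.type free_prod K,
    (forall a, phi (free_prod_inl a) = psi (free_prod_inl a)) ->
    (forall b, phi (free_prod_inr b) = psi (free_prod_inr b)) -> phi =1 psi).
Proof.
split=> [|phi psi el er]; last by apply: pres_morph_ext => -[].
pose h (x : G + H) := match x with inl a => f a | inr b => g b end.
have hR u v : free_prod_rel u v -> word_eval h u = word_eval h v.
  by case=> a b; rewrite /word_eval !big_cons !big_nil !mulg1 /= gmulfM.
have [phi phiE] := pres_lift_exists hR.
by exists phi; split=> [a|b]; exact: phiE.
Qed.

End FreeProduct.

(* The predicates of groupClosed are boolean; with the classical axioms every *)
(* Prop-valued subgroup is of this form, through `[< _ >].                    *)

Definition subgroup (G : groupType) (H : groupClosed G) := {x : G | x \in H}.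

Section Subgroup.
Variables (G : groupType) (H : groupClosed G).

Lemma groupClosed_closed : group_closed H.
Proof. by split=> [|x y xH yH]; [apply: gpred1 | apply: gpredF]. Qed.

HB.instance Definition _ := SubChoice.on (subgroup H).
HB.instance Definition _ :=
  SubChoice_isSubGroup.Build G _ (subgroup H) groupClosed_closed.

End Subgroup.

Section Solvable.
Variable G : groupType.

Definition generated_subgroup (A : set G) : set G :=
  smallest (fun S : set G => group_closed (mem S)) A.

Fixpoint derived_series (n : nat) : set G :=
  if n is m.+1 then
    generated_subgroup [set [~ x, y] | x in derived_series m
                                     & y in derived_series m]
  else setT.

Definition solvable_group : Prop := exists n, derived_series n = [set 1].

Definition finite_index (K : groupClosed G) : Prop :=
  finite_set (range (fun x : G => [set x * k | k in [set k | k \in K]])).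

End Solvable.

Definition virtually_solvable (G : groupType) : Prop :=
  exists2 K : groupClosed G, finite_index K & solvable_group (subgroup K).

Section MixedIdentities.
Variable G : groupType.

Definition mixed_identity (n : nat) (w : free_prod G (free_group 'I_n)) :=
  forall phi : UMagmaMorphism.type (free_prod G (free_group 'I_n)) G,
    (forall g : G, phi (free_prod_inl _ g) = g) -> phi w = 1.

Definition mixed_identity_free : Prop :=
  forall (n : nat) (w : free_prod G (free_group 'I_n)),
    mixed_identity w -> w = 1.

End MixedIdentities.

Section PSL2.
Variable F : fieldType.
Local Open Scope ring_scope.

Definition SL2 := {A : 'M[F]_2 | \det A == 1}.
HB.instance Definition _ := SubChoice.on SL2.

Implicit Types A B C : SL2.

Lemma SL2_mul_subproof A B : \det (val A *m val B) == 1.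
Proof. by rewrite det_mulmx (eqP (valP A)) (eqP (valP B)) mulr1. Qed.

Lemma SL2_one_subproof : \det (1%:M : 'M[F]_2) == 1.
Proof. by rewrite det1. Qed.

Lemma SL2_inv_subproof A : \det (invmx (val A)) == 1.
Proof. by rewrite det_inv (eqP (valP A)) invr1. Qed.

Definition SL2_mul A B : SL2 := exist (fun M : 'M[F]_2 => \det M == 1) _ (SL2_mul_subproof A B).
Definition SL2_one : SL2 := exist (fun M : 'M[F]_2 => \det M == 1) _ SL2_one_subproof.
Definition SL2_inv A : SL2 := exist (fun M : 'M[F]_2 => \det M == 1) _ (SL2_inv_subproof A).

Lemma SL2_unitmx A : val A \in unitmx.
Proof. by rewrite unitmxE (eqP (valP A)) unitr1. Qed.

Lemma SL2_mulA : associative SL2_mul.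
Proof. by move=> A B C; apply: val_inj; rewrite /= mulmxA. Qed.

Lemma SL2_mul1 : left_id SL2_one SL2_mul.
Proof. by move=> A; apply: val_inj; rewrite /= mul1mx. Qed.

Lemma SL2_1mul : right_id SL2_one SL2_mul.
Proof. by move=> A; apply: val_inj; rewrite /= mulmx1. Qed.

Lemma SL2_Vmul : left_inverse SL2_one SL2_inv SL2_mul.
Proof. by move=> A; apply: val_inj; rewrite /= mulVmx // SL2_unitmx. Qed.

Lemma SL2_mulV : right_inverse SL2_one SL2_inv SL2_mul.
Proof. by move=> A; apply: val_inj; rewrite /= mulmxV // SL2_unitmx. Qed.

HB.instance Definition _ := isGroup.Build SL2
  SL2_mulA SL2_mul1 SL2_1mul SL2_Vmul SL2_mulV.

Definition eq_pm : rel SL2 :=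
  fun A B => (val A == val B) || (val A == - val B).

Lemma eq_pm_equiv : equiv_class_of eq_pm.
Proof.
split=> [A|A B|B A C]; rewrite /eq_pm.
- by rewrite eqxx.
- by rewrite eq_sym; congr (_ || _); rewrite -eqr_oppLR eq_sym.
- case/orP=> /eqP ->; case/orP=> /eqP ->; rewrite ?opprK ?eqxx ?orbT //.
Qed.

Canonical eq_pm_equiv_rel := EquivRelPack eq_pm_equiv.

Definition PSL2 := {eq_quot eq_pm}.
HB.instance Definition _ := Choice.on PSL2.
HB.instance Definition _ := EqQuotient.on PSL2.

Definition PSL2_mul (p q : PSL2) := \pi_PSL2 (repr p * repr q)%g.
Definition PSL2_one := \pi_PSL2 1%g.
Definition PSL2_inv (p : PSL2) := \pi_PSL2 (repr p)^-1%g.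

Lemma PSL2_reprP A :
  val (repr (\pi_PSL2 A)) = val A \/ val (repr (\pi_PSL2 A)) = - val A.
Proof.
have : eq_pm (repr (\pi_PSL2 A)) A by rewrite -eqmodE reprK.
by case/orP=> /eqP; [left|right].
Qed.

Lemma PSL2_mulE A B : PSL2_mul (\pi A) (\pi B) = \pi_PSL2 (A * B)%g.
Proof.
apply/eqP; rewrite eqmodE; apply/orP.
rewrite /=; case: (PSL2_reprP A) => ->; case: (PSL2_reprP B) => ->;
  by rewrite ?mulNmx ?mulmxN ?opprK; auto.
Qed.

Lemma PSL2_invE A : PSL2_inv (\pi A) = \pi_PSL2 A^-1%g.
Proof.
apply/eqP; rewrite eqmodE; apply/orP; rewrite /=.
case: (PSL2_reprP A) => ->; first by left.
by right; rewrite -scaleN1r invmxZ ?invrN1 ?scaleN1r // -scaleN1r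
  unitmxZ ?unitrN1 ?SL2_unitmx.
Qed.

Lemma PSL2_mulA : associative PSL2_mul.
Proof.
by move=> p q r; rewrite -[p]reprK -[q]reprK -[r]reprK !PSL2_mulE mulgA.
Qed.

Lemma PSL2_mul1 : left_id PSL2_one PSL2_mul.
Proof. by move=> p; rewrite -[p]reprK PSL2_mulE mul1g. Qed.

Lemma PSL2_1mul : right_id PSL2_one PSL2_mul.
Proof. by move=> p; rewrite -[p]reprK PSL2_mulE mulg1. Qed.

Lemma PSL2_Vmul : left_inverse PSL2_one PSL2_inv PSL2_mul.
Proof. by move=> p; rewrite -[p]reprK PSL2_invE PSL2_mulE mulVg. Qed.

Lemma PSL2_mulV : right_inverse PSL2_one PSL2_inv PSL2_mul.
Proof. by move=> p; rewrite -[p]reprK PSL2_invE PSL2_mulE mulgV. Qed.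

HB.instance Definition _ := isGroup.Build PSL2
  PSL2_mulA PSL2_mul1 PSL2_1mul PSL2_Vmul PSL2_mulV.

End PSL2.

(* Main.v *)
Require Import Defs.
From HB Require Import structures.
From mathcomp Require Import all_boot all_algebra reals complex.
From mathcomp Require Import generic_quotient ring zify.
From mathcomp Require Import boolp classical_sets cardinality.

(* Let G be the preimage in SL_2 of the given subgroup.  If G fixes a line, or
   preserves a pair of lines, it is virtually solvable.  If it fixes no line and
   the eigenvalues of its elements are roots of unity of bounded order, then G
   has finitely many traces; as its elements span the 2x2 matrices, G is finite.

   Otherwise let w be a reduced word with k >= 1 letters x_i^(+-1).  There is a
   in G, diagonal in a suitable basis, whose eigenvalue l has order as large as
   we please compared with w, so that a nonzero polynomial of controlled degree
   does not vanish at all powers of l.  As G preserves neither of the two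
   eigenlines nor the pair, some b in G has four nonzero entries in this basis.
   Conjugators h_i of the form a^p b a^q b can then be chosen so that no entry
   of h_i^-1 c h_j vanishes, for the constants c of w, when i <> j or c is not
   scalar.  Substituting x_i = h_i a^m h_i^-1 and t = l^m, an entry of w becomes
   a Laurent polynomial in t (up to fixed factors) whose coefficient of t^k is a
   product of such entries, hence nonzero, so w is not +-1 for all m. *)

Set Implicit Arguments.
Unset Strict Implicit.
Unset Printing Implicit Defensive.

Import GRing.Theory.
Local Open Scope ring_scope.

(** * Two-by-two matrices *)

Section Matrix2.
Variable R : comUnitRingType.
Implicit Types A B : 'M[R]_2.

Lemma ord2P (i : 'I_2) : i = 0 \/ i = 1.
Proof. by case: i => [[|[|]]] // H; [left|right]; apply/val_inj. Qed.

Lemma mxE2 A B i j : (A *m B) i j = A i 0 * B 0 j + A i 1 * B 1 j.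
Proof.
by rewrite mxE !big_ord_recl big_ord0 addr0; congr (_ + A i _ * B _ j); apply/val_inj.
Qed.

Lemma det_mx22 A : \det A = A 0 0 * A 1 1 - A 0 1 * A 1 0.
Proof.
rewrite (expand_det_row _ 0) !big_ord_recl big_ord0 addr0 /cofactor !det_mx11 !mxE.
rewrite /= expr0 mul1r expr1 mulN1r mulrN.
by congr (_ * A _ _ - A _ _ * A _ _); apply/val_inj.
Qed.

Lemma eq_mx22 A B :
  A 0 0 = B 0 0 -> A 0 1 = B 0 1 -> A 1 0 = B 1 0 -> A 1 1 = B 1 1 -> A = B.
Proof.
by move=> *; apply/matrixP => i j; case: (ord2P i) => ->; case: (ord2P j) => ->.
Qed.

Lemma det1_unitmx A : \det A = 1 -> A \in unitmx.
Proof. by rewrite unitmxE => ->; exact: unitr1. Qed.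

Lemma invmx22 A : \det A = 1 ->
  [/\ invmx A 0 0 = A 1 1, invmx A 0 1 = - A 0 1,
      invmx A 1 0 = - A 1 0 & invmx A 1 1 = A 0 0].
Proof.
move=> dA; rewrite /invmx det1_unitmx // dA invr1 scale1r.
rewrite !mxE /cofactor !det_mx11 !mxE /= expr0 !expr1 !mul1r !mulN1r.
rewrite -signr_odd /= mul1r.
by split; [|congr (- _)|congr (- _)|]; congr (A _ _); apply/val_inj.
Qed.

Lemma det_inv1 A : \det A = 1 -> \det (invmx A) = 1.
Proof. by move=> dA; rewrite det_inv dA invr1. Qed.

Lemma conj_mulmx (P A B : 'M[R]_2) : P \in unitmx ->
  (P *m A *m invmx P) *m (P *m B *m invmx P) = P *m (A *m B) *m invmx P.
Proof. by move=> uP; rewrite !mulmxA mulmxKV. Qed.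

Lemma det_conj (P A : 'M[R]_2) : P \in unitmx ->
  \det (P *m A *m invmx P) = \det A.
Proof.
by move=> uP; rewrite !det_mulmx det_inv mulrC mulrA mulVr ?mul1r // -unitmxE.
Qed.

End Matrix2.

(** * Polynomials in the diagonal parameter and their zeros *)

Section Generic.
Variable F : fieldType.
Implicit Types (A b c d : 'M[F]_2) (t l : F).

Definition nonzero_entries A := forall i j, A i j != 0.

Definition hyp_mx t : 'M[F]_2 :=
  \matrix_(i, j) (if i == j then (if i == 0 then t else t^-1) else 0).

Lemma hyp_mxE t : [/\ hyp_mx t 0 0 = t, hyp_mx t 0 1 = 0,
  hyp_mx t 1 0 = 0 & hyp_mx t 1 1 = t^-1].
Proof. by rewrite !mxE. Qed.

Lemma det_hyp_mx t : t != 0 -> \det (hyp_mx t) = 1.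
Proof. by move=> t0; rewrite det_mx22; case: (hyp_mxE t) => -> -> -> ->; field. Qed.

Lemma hyp_mxM t u : hyp_mx t *m hyp_mx u = hyp_mx (t * u).
Proof.
have [e1 e2 e3 e4] := hyp_mxE t; have [f1 f2 f3 f4] := hyp_mxE u.
have [g1 g2 g3 g4] := hyp_mxE (t * u).
apply: eq_mx22; rewrite mxE2 ?(e1, e2, e3, e4, f1, f2, f3, f4, g1, g2, g3, g4);
  by rewrite ?(mulr0, mul0r, addr0, add0r) // invfM.
Qed.

(** The product of the polynomials has at most [e * size ps] roots, while [l ^+ 0], ..., [l ^+ M]
    are M + 1 distinct elements. *)
Lemma avoid_roots l M (e : nat) (ps : seq {poly F}) :
    l != 0 -> (forall k, (0 < k <= M)%N -> l ^+ k != 1) ->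
    (forall p, p \in ps -> p != 0) -> (forall p, p \in ps -> size p <= e.+1)%N ->
    (e * size ps <= M)%N ->
  exists m, forall p, p \in ps -> p.[l ^+ m] != 0.
Proof.
move=> l0 lM ps0 psd eM; set P := \prod_(p <- ps) p.
have P0 : P != 0.
  rewrite /P big_seq; elim/big_ind: _ => [|p q|p /ps0//].
    exact: oner_neq0.
  exact: mulf_neq0.
have sP : (size P <= (e * size ps).+1)%N.
  rewrite /P; elim: (ps) psd {P P0 ps0 eM} => [|p s IH] psd.
    by rewrite big_nil size_poly1 muln0.
  rewrite big_cons (leq_trans (size_polyMleq _ _)) //.
  have h1 := psd p (mem_head _ _).
  have h2 : (size (\prod_(q <- s) q)%R <= (e * size s).+1)%N.
    by apply: IH => q qs; apply: psd; rewrite in_cons qs orbT.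
  by rewrite mulnS -subn1 leq_subLR (leq_trans (leq_add h1 h2)) // addSn addnS.
suff [m Pm] : exists m, P.[l ^+ m] != 0.
  exists m => p pps; apply: contra Pm => /eqP pm.
  by rewrite /P (big_rem p) //= hornerM pm mul0r.
case: (boolP (all (root P) [seq l ^+ m | m <- iota 0 M.+1])) => [rP|/allPn[x]].
  have /(max_poly_roots P0 rP) : uniq [seq l ^+ m | m <- iota 0 M.+1].
    rewrite map_inj_in_uniq ?iota_uniq // => i j.
    rewrite !mem_iota !add0n !ltnS /=.
    wlog ij : i j / (i <= j)%N => [H iM jM eij|].
      by case/orP: (leq_total i j) => ?; [exact: H|apply/esym/H].
    move=> iM jM; rewrite -{1}(subnK ij) exprD => /eqP.
    rewrite eq_sym -subr_eq0 -[X in _ - X]mul1r -mulrBl mulf_eq0 subr_eq0 expf_eq0.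
    rewrite (negPf l0) andbF orbF => /eqP eij.
    apply/eqP; rewrite eqn_leq ij /= -subn_eq0 eqn0Ngt.
    apply/negP => ji; have := lM (j - i)%N.
    by rewrite ji (leq_trans (leq_subr _ _)) // eij eqxx => /(_ isT).
  by rewrite size_map size_iota => /leq_trans /(_ sP); rewrite ltnS ltnNge eM.
by case/mapP => m _ -> Pm; exists m.
Qed.

Lemma invmxM A B : A \in unitmx -> B \in unitmx ->
  invmx (A *m B) = invmx B *m invmx A.
Proof.
move=> uA uB; apply: (can_inj (mulKmx (_ : A *m B \in unitmx))).
  by rewrite unitmx_mul uA.
by rewrite mulmxV ?unitmx_mul ?uA // mulmxA mulmxK // mulmxV.
Qed.

Lemma invmx_hyp t : t != 0 -> invmx (hyp_mx t) = hyp_mx t^-1.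
Proof.
move=> t0; have [i1 i2 i3 i4] := invmx22 (det_hyp_mx t0).
have [e1 e2 e3 e4] := hyp_mxE t; have [f1 f2 f3 f4] := hyp_mxE t^-1.
by apply: eq_mx22;
  rewrite ?(i1, i2, i3, i4) ?(e1, e2, e3, e4) ?(f1, f2, f3, f4) ?oppr0 ?invrK.
Qed.

Lemma invmx_nonzero A : \det A = 1 -> nonzero_entries A -> nonzero_entries (invmx A).
Proof.
move=> dA A0 i j; have [i1 i2 i3 i4] := invmx22 dA.
by case: (ord2P i) => ->; case: (ord2P j) => ->; rewrite ?(i1, i2, i3, i4) ?oppr_eq0.
Qed.

(** With a = diag(t, 1/t), this is t^2 times the (i, j) entry of (a b)^-1 c (a b), whose exponents
    in t are -2, 0 and 2. *)
Definition conj_poly b c i j : {poly F} :=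
  (invmx b i 0 * c 0 1 * b 1 j)%:P
  + (invmx b i 0 * c 0 0 * b 0 j + invmx b i 1 * c 1 1 * b 1 j) *: 'X^2
  + (invmx b i 1 * c 1 0 * b 0 j) *: 'X^4.

Lemma conj_polyE b c t i j : t != 0 -> \det b = 1 ->
  (conj_poly b c i j).[t] =
  (invmx (hyp_mx t *m b) *m c *m (hyp_mx t *m b)) i j * t ^+ 2.
Proof.
move=> t0 db; rewrite invmxM ?invmx_hyp ?det1_unitmx ?det_hyp_mx //.
have [e1 e2 e3 e4] := hyp_mxE t; have [f1 f2 f3 f4] := hyp_mxE t^-1.
rewrite /conj_poly !(hornerD, hornerZ, hornerC, hornerXn).
rewrite !(mxE2, e1, e2, e3, e4, f1, f2, f3, f4) invrK.
by field.
Qed.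

Lemma size_conj_poly b c i j : (size (conj_poly b c i j) <= 5)%N.
Proof.
apply: leq_trans (size_polyD _ _) _; rewrite geq_max; apply/andP; split.
  apply: leq_trans (size_polyD _ _) _; rewrite geq_max (leq_trans (size_polyC_leq1 _)) //.
  by rewrite (leq_trans (size_scale_leq _ _)) ?size_polyXn.
by rewrite (leq_trans (size_scale_leq _ _)) ?size_polyXn.
Qed.

(** The coefficients of 1 and t^4 are [c 0 1] and [c 1 0] times entries of b^-1 and b, which do not
    vanish. *)
Lemma conj_poly_neq0 b c i j : nonzero_entries b -> \det b = 1 ->
  (c 0 1 != 0) || (c 1 0 != 0) -> conj_poly b c i j != 0.
Proof.
move=> b0 db cd; apply/eqP => p0.
have ib := invmx_nonzero db b0.
have p_0 : (conj_poly b c i j)`_0 = 0 by rewrite p0 coef0.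
have p_4 : (conj_poly b c i j)`_4 = 0 by rewrite p0 coef0.
move: p_0 p_4; rewrite /conj_poly !coefE /= !(mulr0, mulr1, addr0, add0r).
move/eqP; rewrite !mulf_eq0 (negPf (ib _ _)) (negPf (b0 _ _)) orbF /= => c01.
move/eqP; rewrite !mulf_eq0 (negPf (ib _ _)) (negPf (b0 _ _)) orbF /= => c10.
by rewrite c01 c10 in cd.
Qed.

(** If c is diagonal, only the coefficient of t^2 is left. In the upper right entry it is
    [b 1 1 * b 0 1 * (c 0 0 - c 1 1)], nonzero as c is not scalar; in a diagonal entry it could
    vanish. *)
Lemma conj_poly01_neq0 b c : nonzero_entries b -> \det b = 1 ->
  ~~ is_scalar_mx c -> conj_poly b c 0 1 != 0.
Proof.
move=> b0 db cs; case: (boolP ((c 0 1 != 0) || (c 1 0 != 0))) => [|].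
  exact: conj_poly_neq0.
rewrite negb_or !negbK => /andP[/eqP c01 /eqP c10].
have [i1 i2 i3 i4] := invmx22 db.
apply: contra cs => /eqP p0.
have /eqP : (conj_poly b c 0 1)`_2 = 0 by rewrite p0 coef0.
rewrite /conj_poly !coefE /= !(mulr0, mulr1, addr0, add0r) i1 i2.
have -> : b 1 1 * c 0 0 * b 0 1 + - b 0 1 * c 1 1 * b 1 1 =
  b 1 1 * b 0 1 * (c 0 0 - c 1 1) by ring.
rewrite !mulf_eq0 !(negPf (b0 _ _)) /= subr_eq0 => /eqP e.
by apply/is_scalar_mxP; exists (c 0 0); apply: eq_mx22; rewrite ?c01 ?c10 ?e !mxE.
Qed.

(** With a = diag(t, 1/t), this is t times the (i, j) entry of d a b. *)
Definition row_poly b d i j : {poly F} := (d i 1 * b 1 j)%:P + (d i 0 * b 0 j) *: 'X^2.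

Lemma row_polyE b d t i j : t != 0 ->
  (row_poly b d i j).[t] = (d *m (hyp_mx t *m b)) i j * t.
Proof.
move=> t0; have [e1 e2 e3 e4] := hyp_mxE t.
by rewrite /row_poly !(hornerD, hornerZ, hornerC, hornerXn) !(mxE2, e1, e2, e3, e4); field.
Qed.

Lemma size_row_poly b d i j : (size (row_poly b d i j) <= 5)%N.
Proof.
apply: leq_trans (size_polyD _ _) _; rewrite geq_max (leq_trans (size_polyC_leq1 _)) //.
by rewrite (leq_trans (size_scale_leq _ _)) ?size_polyXn.
Qed.

(** If both coefficients vanished, row i of d would be zero, against [\det d = 1]. *)
Lemma row_poly_neq0 b d i j : nonzero_entries b -> \det d = 1 -> row_poly b d i j != 0.
Proof.
move=> b0 dd; apply/eqP => p0.
have p_0 : (row_poly b d i j)`_0 = 0 by rewrite p0 coef0.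
have p_2 : (row_poly b d i j)`_2 = 0 by rewrite p0 coef0.
move: p_0 p_2; rewrite /row_poly !coefE /= !(mulr0, mulr1, addr0, add0r).
move/eqP; rewrite !mulf_eq0 (negPf (b0 _ _)) orbF /= => /eqP d1.
move/eqP; rewrite !mulf_eq0 (negPf (b0 _ _)) orbF /= => /eqP d0.
move/eqP: dd; rewrite det_mx22; case: (ord2P i) d0 d1 => -> -> ->.
  by rewrite !mul0r subr0 eq_sym oner_eq0.
by rewrite !mulr0 subr0 eq_sym oner_eq0.
Qed.

End Generic.

(** A subgroup of SL_2 is given as a predicate on matrices, so that it can be conjugated by any
    invertible matrix. *)
Record sl2_group (F : fieldType) (G : 'M[F]_2 -> Prop) : Prop := Sl2Group {
  sl2_group1 : G 1%:M;
  sl2_groupM : forall A B, G A -> G B -> G (A *m B);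
  sl2_groupV : forall A, G A -> G (invmx A);
  sl2_group_det : forall A, G A -> \det A = 1 }.

(** * Conjugators in general position *)

Section GenericElements.
Variables (F : fieldType) (G : 'M[F]_2 -> Prop) (l : F) (b : 'M[F]_2) (M : nat).
Hypotheses (gG : sl2_group G) (Gl : G (hyp_mx l)) (Gb : G b).
Hypotheses (b0 : nonzero_entries b).
Hypothesis lM : forall k, (0 < k <= M)%N -> l ^+ k != 1.

(** The matrix [hyp_mx 0] has determinant 0, so it cannot lie in G. *)
Lemma hyp_mx_neq0 : l != 0.
Proof.
apply/eqP => l0; have := sl2_group_det gG Gl; have [e1 e2 e3 e4] := hyp_mxE l.
by rewrite det_mx22 e1 e2 l0 !mul0r subr0 => /eqP; rewrite eq_sym oner_eq0.
Qed.

Lemma hyp_mxX m : G (hyp_mx (l ^+ m)).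
Proof.
elim: m => [|m IH]; last by rewrite exprS -hyp_mxM; exact: sl2_groupM.
suff -> : hyp_mx (l ^+ 0) = 1%:M by exact: sl2_group1.
have [e1 e2 e3 e4] := hyp_mxE (l ^+ 0).
by apply: eq_mx22; rewrite ?(e1, e2, e3, e4) !mxE ?expr0 ?invr1.
Qed.

(* In h = a^p b a^q b the factor a^p b makes the upper right entry of the
   conjugate of c nonzero; then a^q b makes all of its entries nonzero.  The
   bound reflects that each step has to avoid the zeros of at most 4 polynomials
   of degree at most 4 per matrix. *)
Lemma exists_generic (C D : seq 'M[F]_2) :
    (forall c, c \in C -> ~~ is_scalar_mx c) ->
    (forall d, d \in D -> \det d = 1) ->
    (20 * (size C + size D) <= M)%N ->
  exists h, [/\ G h, forall c, c \in C -> nonzero_entries (invmx h *m c *m h)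
                   & forall d, d \in D -> nonzero_entries (d *m h)].
Proof.
move=> Cs Dd CDM; have l0 := hyp_mx_neq0.
have db := sl2_group_det gG Gb.
have lX m : l ^+ m != 0 by rewrite expf_neq0.
have [|||m1 m1P] := @avoid_roots _ l M 4 [seq conj_poly b c 0 1 | c <- C] l0 lM.
- by move=> _ /mapP[c cC ->]; apply: conj_poly01_neq0 => //; exact: Cs.
- by move=> _ /mapP[c cC ->]; exact: size_conj_poly.
- by rewrite size_map; lia.
set g1 := hyp_mx (l ^+ m1) *m b.
have Gg1 : G g1 by apply: sl2_groupM => //; exact: hyp_mxX.
have dg1 := sl2_group_det gG Gg1.
have g1C c : c \in C -> (invmx g1 *m c *m g1) 0 1 != 0.
  move=> cC; have := m1P _ (map_f _ cC).
  by rewrite conj_polyE // mulf_eq0 negb_or => /andP[].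
pose I2 := enum {: 'I_2 * 'I_2}.
have sI2 : size I2 = 4 by rewrite -cardE card_prod !card_ord.
pose ps := [seq conj_poly b (invmx g1 *m c *m g1) ij.1 ij.2 | c <- C, ij <- I2]
   ++ [seq row_poly b (d *m g1) ij.1 ij.2 | d <- D, ij <- I2].
have [|||m2 m2P] := @avoid_roots _ l M 4 ps l0 lM.
- move=> p; rewrite mem_cat => /orP[] /allpairsP[[c [i j]] /= [cC _ ->]].
    by apply: conj_poly_neq0; rewrite // g1C.
  by apply: row_poly_neq0; rewrite // det_mulmx dg1 (Dd _ cC) mulr1.
- move=> p; rewrite mem_cat => /orP[] /allpairsP[[c [i j]] /= [cC _ ->]].
    exact: size_conj_poly.
  exact: size_row_poly.
- by move: CDM; rewrite size_cat !size_allpairs sI2; move: (size C) (size D) => x y; lia.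
set g2 := hyp_mx (l ^+ m2) *m b.
have Gg2 : G g2 by apply: sl2_groupM => //; exact: hyp_mxX.
exists (g1 *m g2); split; first exact: sl2_groupM.
- move=> c cC i j; have : conj_poly b (invmx g1 *m c *m g1) i j \in ps.
    rewrite mem_cat; apply/orP; left; apply/allpairsP; exists (c, (i, j)).
    by rewrite mem_enum.
  move/m2P; rewrite conj_polyE // mulf_eq0 negb_or => /andP[+ _].
  rewrite -/g2 (@invmxM _ g1 g2) ?det1_unitmx ?(sl2_group_det gG) //.
  by rewrite !mulmxA.
- move=> d dD i j; have : row_poly b (d *m g1) i j \in ps.
    rewrite mem_cat; apply/orP; right; apply/allpairsP; exists (d, (i, j)).
    by rewrite mem_enum.
  by move/m2P; rewrite row_polyE // mulf_eq0 negb_or => /andP[+ _]; rewrite -/g2 !mulmxA.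
Qed.

(** The [h i] are chosen one after another. Against each earlier h_i, the new g must avoid zeros in
    h_i^-1 d g and, for the reverse order, in h_i^-1 d^-1 g; this accounts for [2 * n * size D]. *)
Lemma exists_generic_family (C D : seq 'M[F]_2) n :
    (forall c, c \in C -> ~~ is_scalar_mx c) ->
    (forall d, d \in D -> \det d = 1) ->
    (20 * (size C + 2 * n * size D) <= M)%N ->
  exists h : nat -> 'M[F]_2,
  [/\ forall i, G (h i),
      forall i c, (i < n)%N -> c \in C -> nonzero_entries (invmx (h i) *m c *m h i)
    & forall i j d, (i < n)%N -> (j < n)%N -> i != j -> d \in D ->
        nonzero_entries (invmx (h i) *m d *m h j)].
Proof.
move=> Cs Dd; elim: n => [|n IH] nM.
  by exists (fun=> 1%:M); split => // _; exact: sl2_group1.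
have [|h [Gh hC hD]] := IH; first by nia.
have Gd i := sl2_group_det gG (Gh i).
pose D' := [seq invmx (h i) *m d | i <- iota 0 n, d <- D]
   ++ [seq invmx (h i) *m invmx d | i <- iota 0 n, d <- D].
have [||g [Gg gC gD]] := @exists_generic C D' Cs.
- move=> p; rewrite mem_cat => /orP[] /allpairsP[[i d] /= [_ dD ->]];
  by rewrite det_mulmx det_inv1 // ?det_inv1 ?Dd ?mulr1.
- by move: nM; rewrite size_cat !size_allpairs size_iota; move: (size C) (size D) => x y; nia.
have gdet := sl2_group_det gG Gg.
exists (fun i => if i == n then g else h i); split.
- by move=> i; case: ifP.
- by move=> i c; rewrite ltnS leq_eqVlt; case: eqP => [_ _|_]; [exact: gC|exact: hC].
move=> i j d; rewrite !ltnS (leq_eqVlt i) (leq_eqVlt j).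
case: (eqVneq i n) => [->|_]; case: (eqVneq j n) => [->|_] //=; rewrite ?eqxx //.
- move=> _ jn _ dD.
  (* Inverting a matrix of determinant 1 only moves its entries and changes signs, so the reverse
     order reduces to the list with d^-1. *)
  have -> : invmx g *m d *m h j = invmx (invmx (h j) *m invmx d *m g).
    have [uh ud ug] : [/\ h j \in unitmx, d \in unitmx & g \in unitmx].
      by split; apply: det1_unitmx => //; exact: Dd.
    by rewrite !invmxM ?invmxK ?unitmx_mul ?unitmx_inv ?uh ?ud ?mulmxA.
  apply: invmx_nonzero.
    by rewrite !det_mulmx !det_inv1 ?gdet ?(Dd _ dD) // !mulr1.
  apply: gD; rewrite mem_cat; apply/orP; right; apply/allpairsP; exists (j, d).
  by rewrite mem_iota.
- move=> i_n _ _ dD; apply: gD; rewrite mem_cat; apply/orP; left.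
  by apply/allpairsP; exists (i, d); rewrite mem_iota.
- exact: hD.
Qed.

(** * Leading coefficients of products with diagonal factors *)

Let ix (s : bool) : 'I_2 := if s then 1 else 0.

(* A pair (s, d) stands for the product diag(t, 1/t)^(+-1) d, with exponent -1
   when s holds; multiplying by t for each pair makes the entries polynomial. *)
Fixpoint chain_val (t : F) (u : seq (bool * 'M[F]_2)) : 'M[F]_2 :=
  if u is (s, d) :: u' then
    hyp_mx (if s then t^-1 else t) *m d *m chain_val t u'
  else 1%:M.

Fixpoint chain_poly (u : seq (bool * 'M[F]_2)) (i j : 'I_2) : {poly F} :=
  if u is (s, d) :: u' then
    (if i == ix s then 'X^2 else 1) *
      (d i 0 *: chain_poly u' 0 j + d i 1 *: chain_poly u' 1 j)
  else (i == j)%:R.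

(** [ix s] is the place of t, rather than 1/t, in diag(t, 1/t)^(+-1). Under [chain_ok], row [hd u j]
    is the only one to reach the top degree in column j; the empty product is the identity, hence
    the value j. *)
Let hd (u : seq (bool * 'M[F]_2)) (j : 'I_2) := if u is (s, _) :: _ then ix s else j.

(** The top coefficient is the product of exactly these entries. *)
Fixpoint chain_ok (u : seq (bool * 'M[F]_2)) (j : 'I_2) :=
  if u is (s, d) :: u' then (d (ix s) (hd u' j) != 0) && chain_ok u' j else true.

Lemma chain_polyE t u i j : t != 0 ->
  (chain_poly u i j).[t] = t ^+ size u * chain_val t u i j.
Proof.
move=> t0; elim: u i => [|[s d] u IH] i /=.
  by rewrite mxE expr0 mul1r; case: (i == j); rewrite !hornerE.
rewrite !(hornerM, hornerD, hornerZ) !IH.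
have [e1 e2 e3 e4] := hyp_mxE (if s then t^-1 else t).
have -> : (if i == ix s then 'X^2 else 1 : {poly F}).[t] = if i == ix s then t ^+ 2 else 1.
  by case: ifP; rewrite ?hornerXn // -polyC1 hornerC.
rewrite !mxE2.
case: (ord2P i) => ->; rewrite ?(e1, e2, e3, e4); case: s {e1 e2 e3 e4} => /=;
  by rewrite (exprS t (size u)) ?invrK; move: (t ^+ size u) => T; field.
Qed.

(* Each factor diag(t^2, 1) d or diag(1, t^2) d raises the top degree by 2 in one
   row only, so the top coefficient is multiplied by a single entry of d. *)
Lemma chain_poly_lead u j : chain_ok u j ->
  (forall i, size (chain_poly u i j) <= (2 * size u).+1)%N /\
  (forall i, ((chain_poly u i j)`_(2 * size u) != 0) = (i == hd u j)).
Proof.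
elim: u => [|[s d] u IH] /=.
  move=> _; split=> i; first by case: (i == j); rewrite ?size_poly1 ?size_poly0.
  by rewrite muln0; case: (i == j); rewrite coefC ?oner_eq0 ?eqxx.
case/andP => d0 /IH[su cu].
set q := fun i : 'I_2 => d i 0 *: chain_poly u 0 j + d i 1 *: chain_poly u 1 j.
have sq i : (size (q i) <= (2 * size u).+1)%N.
  apply: leq_trans (size_polyD _ _) _.
  by rewrite geq_max !(leq_trans (size_scale_leq _ _)).
rewrite mulnS; split=> i; rewrite -/(q i); case: ifP => // e.
- apply: leq_trans (size_polyMleq _ _) _.
  by rewrite size_polyXn /= !addSn add0n !ltnS.
- by rewrite mul1r (leq_trans (sq i)) // ltnS leq_addl.
- rewrite coefXnM ltnNge leq_addr addKn /= coefD !coefZ (eqP e).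
  move: d0 (cu 0) (cu 1); case: (ord2P (hd u j)) => -> d0 c0 c1.
    by move/negbFE/eqP: c1 => ->; rewrite mulr0 addr0 mulf_neq0 // c0.
  by move/negbFE/eqP: c0 => ->; rewrite mulr0 add0r mulf_neq0 // c1.
- by rewrite mul1r nth_default ?eqxx // (leq_trans (sq i)).
Qed.

(** After multiplication by t^k, with k = [size u], the chosen entry has degree 2k, while that of e
    or -e has degree at most k < 2k. Two polynomials of degree at most 2k must be nonzero at t,
    hence the bound 4k. *)
Lemma chain_val_neq u j e : (4 * size u <= M)%N -> (0 < size u)%N -> chain_ok u j ->
  exists m, chain_val (l ^+ m) u <> e /\ chain_val (l ^+ m) u <> - e.
Proof.
move=> uM u0 /chain_poly_lead[su /(_ (hd u j))].
rewrite eqxx; set i := hd u j; set q := chain_poly u i j; set k := size u => qk.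
pose y : {poly F} := e i j *: 'X^k.
have yk : y`_(2 * k) = 0.
  rewrite coefZ coefXn (_ : (_ == _) = false) ?mulr0 //.
  by apply/negbTE; rewrite -{2}[k]mul1n eqn_pmul2r.
have sy : (size y <= (2 * k).+1)%N.
  by rewrite (leq_trans (size_scale_leq _ _)) // size_polyXn ltnS leq_pmull.
have n1 : q - y != 0.
  by apply: contra qk => /eqP z; have := coefB q y (2 * k); rewrite yk z coef0 subr0 => <-.
have n2 : q + y != 0.
  by apply: contra qk => /eqP z; have := coefD q y (2 * k); rewrite yk z coef0 addr0 => <-.
have [|||m mP] := @avoid_roots _ l M (2 * k) [:: q - y; q + y] hyp_mx_neq0 lM.
- by move=> p; rewrite !inE => /orP[] /eqP ->.
- have sq := su i.
  by move=> p; rewrite !inE => /orP[] /eqP ->; apply: leq_trans (size_polyD _ _) _;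
    rewrite ?size_polyN geq_max (su i).
- by rewrite /= mulnC mulnA.
have l0 : l ^+ m != 0 by rewrite expf_neq0 ?hyp_mx_neq0.
exists m; split => z.
  have /eqP[] := mP _ (mem_head _ _).
  by rewrite hornerD hornerN /q chain_polyE // z hornerZ hornerXn -/k; ring.
have /eqP[] : (q + y).[l ^+ m] != 0 by apply: mP; rewrite !inE eqxx orbT.
by rewrite hornerD /q chain_polyE // z hornerZ hornerXn -/k mxE; ring.
Qed.

End GenericElements.

(** * Words with constants *)

Section Words.
Variables (I : eqType) (T : Type) (trivial : pred T).

(* (i, s, c) stands for x_i^(+-1) c, with exponent -1 when s holds. *)
Fixpoint reduced (w : seq (I * bool * T)) : bool :=
  if w is (i, s, c) :: w' then
    (if w' is (j, s', _) :: _ then (trivial c && (i == j)) ==> (s == s') else true)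
    && reduced w'
  else true.

End Words.

Section MatrixWords.
Variable F : fieldType.
Implicit Types (w : seq (nat * bool * 'M[F]_2)) (h x : nat -> 'M[F]_2).

Fixpoint word_val x w : 'M[F]_2 :=
  if w is (i, s, c) :: w' then
    (if s then invmx (x i) else x i) *m c *m word_val x w'
  else 1%:M.

Let head_mx h w : 'M[F]_2 := if w is (i, _, _) :: _ then h i else 1%:M.

(** After x_i = h_i a h_i^-1 the factors a^(+-1) are separated by h_i^-1 c h_j, where j is the next
    index. Past the last letter [head_mx] is the identity, so the last block is h_i^-1 c; the very
    first h_i is split off. *)
Fixpoint word_chain h w : seq (bool * 'M[F]_2) :=
  if w is (i, s, c) :: w' then
    (s, invmx (h i) *m c *m head_mx h w') :: word_chain h w'
  else [::].

Lemma size_word_chain h w : size (word_chain h w) = size w.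
Proof. by elim: w => [|[[i s] c] w IH] //=; rewrite IH. Qed.

Lemma word_val_chain h t w : t != 0 -> (forall i, \det (h i) = 1) ->
  word_val (fun i => h i *m hyp_mx t *m invmx (h i)) w =
  head_mx h w *m chain_val t (word_chain h w).
Proof.
move=> t0 dh; elim: w => [|[[i s] c] w IH] /=; first by rewrite mulmx1.
have uh i' : h i' \in unitmx by exact: det1_unitmx.
rewrite IH !mulmxA; congr (_ *m _ *m _ *m _); case: s => //.
rewrite !invmxM ?invmxK ?unitmx_mul ?unitmx_inv ?uh //= ?det1_unitmx ?det_hyp_mx //.
by rewrite invmx_hyp // mulmxA.
Qed.

(** A block between two letters has no zero entry unless their indices agree and c is scalar. In
    that case the signs agree, as the word is reduced, and the entry in question lies on the
    diagonal of a nonzero scalar matrix. The column j comes from the last block, whose rows are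
    nonzero. *)
Lemma word_chain_ok h w :
    (forall i s c, (i, s, c) \in w -> \det (invmx (h i) *m c) = 1) ->
    (forall i s c j s' c', (i, s, c) \in w -> (j, s', c') \in w ->
      i != j -> nonzero_entries (invmx (h i) *m c *m h j)) ->
    (forall i s c, (i, s, c) \in w -> ~~ is_scalar_mx c ->
      nonzero_entries (invmx (h i) *m c *m h i)) ->
    (forall i, \det (h i) = 1) ->
    reduced is_scalar_mx w ->
  exists j, chain_ok (word_chain h w) j.
Proof.
move=> + + + dh; elim: w => [|[[i s] c] w IH] w1 w2 w3 /=; first by exists 0.
case: w IH w1 w2 w3 => [|[[i' s'] c'] w] IH w1 w2 w3 /andP[red1 red].
  have d1 := w1 _ _ _ (mem_head _ _); rewrite /= mulmx1 /=.
  suff [j dj] : exists j, (invmx (h i) *m c) (if s then 1 else 0) j != 0.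
    by exists j; rewrite dj.
  set r : 'I_2 := if s then 1 else 0; set d := invmx (h i) *m c in d1 *.
  have [d0|] := eqVneq (d r 0) 0; last by exists 0.
  have [d1'|] := eqVneq (d r 1) 0; last by exists 1.
  have := oner_neq0 F; rewrite -d1 det_mx22.
  by case: (ord2P r) d0 d1' => -> -> ->; rewrite ?(mul0r, mulr0) subr0 eqxx.
have [|||j ok] := IH _ _ _ red.
- by move=> i1 s1 c1 H; apply: (w1 i1 s1); rewrite inE H orbT.
- move=> i1 s1 c1 i2 s2 c2 H H'; apply: (w2 i1 s1 c1 i2 s2 c2);
  by rewrite in_cons ?H ?H' orbT.
- by move=> i1 s1 c1 H; apply: (w3 i1 s1); rewrite inE H orbT.
exists j; move: ok => /= -> /=; rewrite andbT.
have [ii|ii] := eqVneq i i'; last first.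
  by apply: (w2 i s c i' s' c') => //; rewrite !inE eqxx ?orbT.
have [cs|cs] := boolP (is_scalar_mx c); last first.
  by rewrite -ii; apply: (w3 i s c) => //; rewrite inE eqxx.
move: red1; rewrite cs ii eqxx /= => /eqP <-.
have [z cz] := is_scalar_mxP cs.
have z0 : z != 0.
  apply/eqP => z0; have := w1 _ _ _ (mem_head _ _).
  rewrite cz z0 det_mulmx det_scalar expr0n mulr0 => /eqP.
  by rewrite eq_sym oner_eq0.
rewrite cz mul_mx_scalar -scalemxAl mulVmx ?det1_unitmx //.
by rewrite !mxE eqxx mulr1.
Qed.

Lemma word_val_neq (G : 'M[F]_2 -> Prop) l b M n w e :
    sl2_group G -> G (hyp_mx l) -> G b -> nonzero_entries b ->
    (forall k, (0 < k <= M)%N -> l ^+ k != 1) ->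
    (20 * (size w + 2 * n * size w) <= M)%N ->
    w != [::] -> reduced is_scalar_mx w ->
    (forall i s c, (i, s, c) \in w -> (i < n)%N /\ \det c = 1) ->
  exists x, [/\ forall i, G (x i), word_val x w <> e & word_val x w <> - e].
Proof.
move=> gG Gl Gb b0 lM wM w0 red wn.
(* All constants must be in general position between different indices, the nonscalar ones also
   within a single index. *)
pose D := [seq p.2 | p <- w]; pose C := [seq c <- D | ~~ is_scalar_mx c].
have CD : (size C <= size w)%N by rewrite size_filter (leq_trans (count_size _ _)) // size_map.
have wD i s c : (i, s, c) \in w -> c \in D by move=> H; apply/mapP; exists (i, s, c).
have [|||h [Gh hC hD]] := @exists_generic_family _ _ _ _ _ gG Gl Gb b0 lM C D n.
- by move=> c; rewrite mem_filter => /andP[].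
- by move=> _ /mapP[[[i s] c] H ->]; have [] := wn _ _ _ H.
- rewrite (leq_trans _ wM) // size_map.
  by move: (size C) (size w) CD => u v CD; nia.
have dh i := sl2_group_det gG (Gh i).
have [|||j ok] := @word_chain_ok h w _ _ _ dh red.
- by move=> i s c /wn[_ dc]; rewrite det_mulmx det_inv1 // dc mulr1.
- move=> i s c j s' c' H H' ij; have [ni _] := wn _ _ _ H; have [nj _] := wn _ _ _ H'.
  by apply: hD => //; exact: wD H.
- move=> i s c H cs; have [ni _] := wn _ _ _ H.
  by apply: hC => //; rewrite mem_filter cs; exact: wD H.
have l0 := hyp_mx_neq0 gG Gl.
have uH : head_mx h w \in unitmx.
  by case: (w) => [|[[i s] c] w'] /=; rewrite ?unitmx1 ?det1_unitmx.
have [||m [m1 m2]] := @chain_val_neq _ _ _ _ gG Gl lM (word_chain h w) j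
  (invmx (head_mx h w) *m e) _ _ ok.
- by rewrite size_word_chain (leq_trans _ wM) //; move: (size w) => u; nia.
- by rewrite size_word_chain lt0n size_eq0.
exists (fun i => h i *m hyp_mx (l ^+ m) *m invmx (h i)).
rewrite word_val_chain ?expf_neq0 //; split.
- move=> i; apply: sl2_groupM => //; last exact: sl2_groupV.
  by apply: sl2_groupM => //; exact: hyp_mxX.
- by move=> z; apply: m1; rewrite -z mulKmx.
- by move=> z; apply: m2; rewrite -mulmxN -z mulKmx.
Qed.

(** Diagonal or antidiagonal: an invertible g of this form preserves the pair of coordinate
    lines. *)
Definition monomial (g : 'M[F]_2) :=
  (g 0 1 == 0) && (g 1 0 == 0) || (g 0 0 == 0) && (g 1 1 == 0).

(* If column p of u and row p of v have no zero entry, neither has u a^m v for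
   some m; such u and v are found among g, k1, k2 and their products. *)
Lemma exists_nonzero_entries (G : 'M[F]_2 -> Prop) l :
    sl2_group G -> G (hyp_mx l) -> (forall k, (0 < k <= 16)%N -> l ^+ k != 1) ->
    (exists2 g, G g & g 0 1 != 0) -> (exists2 g, G g & g 1 0 != 0) ->
    (exists2 g, G g & ~~ monomial g) ->
  exists2 b, G b & nonzero_entries b.
Proof.
move=> gG Gl l16 [k1 Gk1 k1_01] [k2 Gk2 k2_10] [g Gg].
have l0 := hyp_mx_neq0 gG Gl.
(* The coefficients of [row_poly v u i j] are [u i 0 * v 0 j] and [u i 1 * v 1 j], and the one
   belonging to p is nonzero. Four polynomials of degree at most 4 explain the 16. *)
have combine (p : 'I_2) (u v : 'M[F]_2) : G u -> G v ->
    (forall i, u i p != 0) -> (forall j, v p j != 0) ->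
    exists2 b, G b & nonzero_entries b.
  move=> Gu Gv up vp; pose I2 := enum {: 'I_2 * 'I_2}.
  have [|||m mP] := @avoid_roots _ l 16 4 [seq row_poly v u ij.1 ij.2 | ij <- I2] l0 l16.
  - move=> _ /mapP[[i j] _ ->]; apply/eqP => z.
    have e1 : (row_poly v u i j)`_0 = 0 by rewrite z coef0.
    have e2 : (row_poly v u i j)`_2 = 0 by rewrite z coef0.
    move: e1 e2 (up i) (vp j).
    rewrite /row_poly !coefE /= !(mulr0, mulr1, addr0, add0r) => /eqP e1 /eqP e2.
    case: (ord2P p) => -> up' vp'.
      by move: e2; rewrite mulf_eq0 (negPf up') (negPf vp').
    by move: e1; rewrite mulf_eq0 (negPf up') (negPf vp').
  - by move=> _ /mapP[[i j] _ ->]; exact: size_row_poly.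
  - by rewrite size_map -cardE card_prod !card_ord.
  exists (u *m (hyp_mx (l ^+ m) *m v)).
    by do 2![apply: sl2_groupM => //]; exact: hyp_mxX.
  move=> i j; have : (row_poly v u i j).[l ^+ m] != 0.
    by apply: mP; apply/mapP; exists (i, j); rewrite ?mem_enum.
  by rewrite row_polyE ?expf_neq0 // mulf_eq0 negb_or => /andP[].
have dg := sl2_group_det gG Gg.
have I2P (q : 'I_2 -> F) : q 0 != 0 -> q 1 != 0 -> forall i, q i != 0.
  by move=> q0 q1 i; case: (ord2P i) => ->.
rewrite /monomial negb_or !negb_and.
have [g00|g00] := eqVneq (g 0 0) 0.
  move=> /andP[_ /= g11]; have /andP[g01 g10] : (g 0 1 != 0) && (g 1 0 != 0).
    rewrite -negb_or -mulf_eq0; apply/eqP => z.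
    by have := oner_neq0 F; rewrite -dg det_mx22 g00 z mul0r subr0 eqxx.
  by apply: (combine 1 g g) => //; exact: I2P.
have [g11|g11] := eqVneq (g 1 1) 0.
  have /andP[g01 g10] : (g 0 1 != 0) && (g 1 0 != 0).
    rewrite -negb_or -mulf_eq0; apply/eqP => z.
    by have := oner_neq0 F; rewrite -dg det_mx22 g11 z mulr0 subr0 eqxx.
  by move=> _; apply: (combine 0 g g) => //; exact: I2P.
(* Here both diagonal entries are nonzero. If [g 0 1] vanishes, column 0 of g has no zero, and row 0
   of k1 or of k1 g is its partner; the mirror case uses k2. *)
have [g01|g01] := eqVneq (g 0 1) 0; rewrite /= ?andbT => g10.
  suff [k [Gk k00 k01]] : exists k, [/\ G k, k 0 0 != 0 & k 0 1 != 0].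
    by apply: (combine 0 g k) => //; exact: I2P.
  have [k00|k00] := eqVneq (k1 0 0) 0; last by exists k1.
  exists (k1 *m g); split; first exact: sl2_groupM.
    by rewrite mxE2 k00 mul0r add0r mulf_neq0.
  by rewrite mxE2 g01 mulr0 add0r mulf_neq0.
have [g10'|g10'] := eqVneq (g 1 0) 0.
  suff [k [Gk k00 k01]] : exists k, [/\ G k, k 1 0 != 0 & k 1 1 != 0].
    by apply: (combine 1 g k) => //; exact: I2P.
  have [k11|k11] := eqVneq (k2 1 1) 0; last by exists k2.
  exists (k2 *m g); split; first exact: sl2_groupM.
    by rewrite mxE2 g10' mulr0 addr0 mulf_neq0.
  by rewrite mxE2 k11 mul0r addr0 mulf_neq0.
by exists g => // i j; case: (ord2P i) => ->; case: (ord2P j) => ->.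
Qed.

(** * Diagonalisation by eigenvectors *)

Lemma row_neq0P (v : 'rV[F]_2) : v != 0 -> (v 0 0 != 0) || (v 0 1 != 0).
Proof.
apply: contraR; rewrite negb_or !negbK => /andP[/eqP v0 /eqP v1].
by apply/eqP/rowP => i; rewrite mxE; case: (ord2P i) => ->.
Qed.

Lemma exists_eigenvector (g : 'M[F]_2) l : l != 0 -> \det g = 1 ->
  \tr g = l + l^-1 -> exists2 v : 'rV_2, v != 0 & v *m g = l *: v.
Proof.
move=> l0 dg tg; have /det0P[v v0 vg] : \det (g - l%:M) == 0.
  rewrite det_mx22 !mxE /= !mulr1n !mulr0n !subr0.
  have -> : (g 0 0 - l) * (g 1 1 - l) - g 0 1 * g 1 0 =
    \det g - l * (g 0 0 + g 1 1) + l * l by rewrite det_mx22; ring.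
  have -> : g 0 0 + g 1 1 = \tr g.
    by rewrite /mxtrace !big_ord_recl big_ord0 addr0; congr (_ + g _ _); apply/val_inj.
  by rewrite dg tg; apply/eqP; field.
exists v => //; apply/eqP; rewrite -subr_eq0 -mul_mx_scalar -mulmxBr.
exact/eqP.
Qed.

(** Eigenvectors for l and 1/l form the rows of P; they are independent because [l ^+ 2 != 1] makes
    the eigenvalues distinct. *)
Lemma hyperbolic_diagonalizable (g : 'M[F]_2) l : l != 0 -> l ^+ 2 != 1 ->
    \det g = 1 -> \tr g = l + l^-1 ->
  exists2 P, P \in unitmx & P *m g *m invmx P = hyp_mx l.
Proof.
move=> l0 l2 dg tg.
have [v v0 vg] := exists_eigenvector l0 dg tg.
have [||u u0 ug] := @exists_eigenvector g l^-1 _ dg; rewrite ?invr_neq0 //.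
  by rewrite tg invrK addrC.
pose P : 'M[F]_2 := \matrix_(i, j) if i == 0 then v 0 j else u 0 j.
have [e1 e2 e3 e4] := hyp_mxE l.
have Pg : P *m g = hyp_mx l *m P.
  apply/matrixP => i j; rewrite !mxE2 !mxE /=.
  case: (ord2P i) => ->; rewrite /= ?mul0r ?addr0 ?add0r.
    by move/rowP/(_ j): vg; rewrite !mxE !big_ord_recl big_ord0 addr0 => <-;
      congr (_ + v _ _ * g _ _); apply/val_inj.
  by move/rowP/(_ j): ug; rewrite !mxE !big_ord_recl big_ord0 addr0 => <-;
    congr (_ + u _ _ * g _ _); apply/val_inj.
suff uP : P \in unitmx by exists P; rewrite // Pg mulmxK.
rewrite unitmxE unitfE; apply/det0P => -[z z0 zP].
have zlP : z *m hyp_mx l *m P = 0 by rewrite -mulmxA -Pg mulmxA zP mul0mx.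
have E j : z 0 0 * v 0 j + z 0 1 * u 0 j = 0.
  move/rowP/(_ j): zP; rewrite !mxE !big_ord_recl big_ord0 addr0 !mxE /=.
  by move=> <-; congr (_ + z _ _ * _); apply/val_inj.
have E' j : z 0 0 * l * v 0 j + z 0 1 * l^-1 * u 0 j = 0.
  move/rowP/(_ j): zlP; rewrite !mxE !big_ord_recl !big_ord0 !mxE /=.
  rewrite !big_ord_recl !big_ord0 !mxE /=.
  move=> <-; rewrite !(mulr0, addr0, add0r).
  by congr (_ + z _ _ * _ * _); apply/val_inj.
have ll : l - l^-1 != 0.
  by apply: contra l2; rewrite subr_eq0 expr2 => /eqP {1}->; rewrite mulVf.
have z1 : z 0 1 = 0.
  have [j uj] : exists j, u 0 j != 0 by case/orP: (row_neq0P u0); [exists 0|exists 1].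
  (* Subtracting [E'] from l times [E] eliminates v. *)
  apply/eqP; have : z 0 1 * (u 0 j * (l - l^-1)) = 0.
    transitivity (l * (z 0 0 * v 0 j + z 0 1 * u 0 j) -
      (z 0 0 * l * v 0 j + z 0 1 * l^-1 * u 0 j)); first by ring.
    by rewrite E E' mulr0 subr0.
  by move/eqP; rewrite mulf_eq0 (negPf (mulf_neq0 uj ll)) orbF.
case/orP: (row_neq0P z0); last by rewrite z1 eqxx.
move/negP; apply.
have [j vj] : exists j, v 0 j != 0 by case/orP: (row_neq0P v0); [exists 0|exists 1].
by move/eqP: (E j); rewrite z1 mul0r addr0 mulf_eq0 (negPf vj) orbF.
Qed.

End MatrixWords.

(** * Subgroups of SL_2 *)

Section Dichotomy.
Variables (F : fieldType) (G : 'M[F]_2 -> Prop).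
Hypothesis gG : sl2_group G.

Definition fixes_line :=
  exists2 v : 'rV[F]_2, v != 0 & forall g, G g -> exists l, v *m g = l *: v.

Lemma mul_rV2E (v : 'rV[F]_2) (g : 'M_2) j : (v *m g) 0 j = v 0 0 * g 0 j + v 0 1 * g 1 j.
Proof.
by rewrite !mxE !big_ord_recl big_ord0 addr0; congr (_ + v _ _ * g _ _); apply/val_inj.
Qed.

Lemma sl2_group_conj P : P \in unitmx -> sl2_group (fun A => G (invmx P *m A *m P)).
Proof.
move=> uP; split=> [|A B GA GB|A GA|A /(sl2_group_det gG)].
- by rewrite mulmx1 mulVmx //; exact: sl2_group1.
- have := sl2_groupM gG GA GB; rewrite !mulmxA.
  by rewrite -[_ *m P *m invmx P]mulmxA mulmxV // mulmx1.
- have uA : A \in unitmx.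
    have := det1_unitmx (sl2_group_det gG GA).
    by rewrite !unitmx_mul unitmx_inv uP andbT.
  have := sl2_groupV gG GA.
  by rewrite !invmxM ?unitmx_mul ?unitmx_inv ?uP ?uA // invmxK mulmxA.
- by rewrite -[X in _ *m X](invmxK P) det_conj // unitmx_inv.
Qed.

Lemma word_val_conj P (x : nat -> 'M[F]_2) w : P \in unitmx ->
  word_val (fun i => invmx P *m x i *m P) w =
  invmx P *m word_val x [seq (u.1.1, u.1.2, P *m u.2 *m invmx P) | u <- w] *m P.
Proof.
move=> uP; elim: w => [|[[i s] c] w IH] /=; first by rewrite mulmx1 mulVmx.
rewrite {}IH.
have -> : (if s then invmx (invmx P *m x i *m P) else invmx P *m x i *m P) =
   invmx P *m (if s then invmx (x i) else x i) *m P.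
  (* [invmx] returns a singular matrix unchanged, so the identity persists for singular [x i]. *)
  case: s => //; case: (boolP (x i \in unitmx)) => ux.
    by rewrite !invmxM ?unitmx_mul ?unitmx_inv ?uP ?ux // invmxK mulmxA.
  by rewrite /invmx !unitmx_mul unitmx_inv uP (negPf ux).
by rewrite !mulmxA.
Qed.

Lemma is_scalar_conj (P c : 'M[F]_2) : P \in unitmx ->
  is_scalar_mx (P *m c *m invmx P) -> is_scalar_mx c.
Proof.
move=> uP /is_scalar_mxP[a e]; apply/is_scalar_mxP; exists a.
have -> : c = invmx P *m (P *m c *m invmx P) *m P.
  by rewrite !mulmxA mulVmx // mul1mx mulmxKV.
by rewrite e mul_mx_scalar -scalemxAl mulVmx // scalemx1.
Qed.

(** Serves to conjugate the constants of a word and to carry a word over the group to one over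
    matrices: no new cancellation arises if only trivial constants become trivial. *)
Lemma sub_reduced (I J : eqType) (T T' : Type) (h : I -> J) (f : T -> T')
    (p : pred T) (q : pred T') w :
  injective h -> (forall c, q (f c) -> p c) ->
  reduced p w -> reduced q [seq (h u.1.1, u.1.2, f u.2) | u <- w].
Proof.
move=> hI qp; elim: w => [|[[i s] c] w IH] //= /andP[e /IH ->]; rewrite andbT.
case: w e {IH} => [|[[j s'] c'] w] //= /implyP e; apply/implyP => /andP[/qp pc].
by rewrite (inj_eq hI) => ij; apply: e; rewrite pc.
Qed.

Theorem word_val_neq_of_unbounded n w e :
    ~ fixes_line ->
    ~ (exists2 P, P \in unitmx & forall g, G g -> monomial (P *m g *m invmx P)) ->
    (forall k, (0 < k)%N -> exists g l,
      [/\ G g, l != 0, \tr g = l + l^-1 & l ^+ k != 1]) ->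
    w != [::] -> reduced (@is_scalar_mx F 2) w ->
    (forall i s c, (i, s, c) \in w -> (i < n)%N /\ \det c = 1) ->
  exists x, [/\ forall i, G (x i), word_val x w <> e & word_val x w <> - e].
Proof.
move=> irr prim unb w0 red wn.
(* The 16 serves the search for b, the other bound the word. Every k with 0 < k <= M divides M!, so
   l^(M!) <> 1 excludes l^k = 1 for all of them. *)
pose M := maxn 16 (20 * (size w + 2 * n * size w)).
have [g [l [Gg l0 tg lM]]] := unb M`! (fact_gt0 M).
have {}lM k : (0 < k <= M)%N -> l ^+ k != 1.
  move=> kM; apply: contra lM => /eqP lk.
  by have /dvdnP[q ->] := dvdn_fact kM; rewrite mulnC exprM lk expr1n.
have dg := sl2_group_det gG Gg.
have [|P uP Pg] := @hyperbolic_diagonalizable _ g l l0 _ dg tg.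
  by apply: lM; rewrite leq_max.
have gH := sl2_group_conj uP; set H := fun _ => _ in gH.
have HP k : G k -> H (P *m k *m invmx P).
  by rewrite /H !mulmxA mulVmx // mul1mx mulmxKV.
(* If all elements of H had a zero at (r, r'), row r of P would span a line fixed by G. *)
have offdiag (r r' : 'I_2) : r != r' -> exists2 k, H k & k r r' != 0.
  move=> rr'; apply: contrapT => no; apply: irr; exists (row r P).
    apply/eqP => rP; have := oner_neq0 F.
    have /rowP/(_ r) : row r (P *m invmx P) = 0 by rewrite row_mul rP mul0mx.
    by rewrite mulmxV // !mxE eqxx mulr1n => ->; rewrite eqxx.
  move=> k Gk; have Qrr' : (P *m k *m invmx P) r r' = 0.
    by apply/eqP/negPn/negP => z; apply: no; exists (P *m k *m invmx P) => //; exact: HP.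
  have QP : P *m k *m invmx P *m P = P *m k by rewrite mulmxKV.
  move: (P *m k *m invmx P) Qrr' QP => Q Qrr' QP.
  exists (Q r r); rewrite -row_mul -QP row_mul; apply/rowP => j; rewrite mul_rV2E !mxE.
  by case: (ord2P r) (ord2P r') rr' Qrr' => -> [] -> //= _ ->;
    rewrite mul0r ?addr0 ?add0r.
have [|||||b Hb b0] := @exists_nonzero_entries _ H l gH.
- by rewrite -Pg; exact: HP.
- by move=> k /andP[k0 k16]; apply: lM; rewrite k0 leq_max k16.
- exact: offdiag.
- exact: offdiag.
- apply: contrapT => no; apply: prim; exists P => // k Gk.
  by apply/negPn/negP => z; apply: no; exists (P *m k *m invmx P) => //; exact: HP.
pose w' := [seq (u.1.1, u.1.2, P *m u.2 *m invmx P) | u <- w].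
have [|||||x [Hx x1 x2]] := @word_val_neq _ H l b M n w' (P *m e *m invmx P) gH _ Hb b0 lM.
- by rewrite -Pg; exact: HP.
- by rewrite size_map leq_max leqnn orbT.
- by rewrite -size_eq0 size_map size_eq0.
- apply: (@sub_reduced _ _ _ _ id (fun c => P *m c *m invmx P) _ _ _ _ _ red) => //.
  by move=> c; exact: is_scalar_conj.
- by move=> i s c /mapP[[[i' s'] c'] /wn[ni dc]] [-> _ ->]; rewrite det_conj.
exists (fun i => invmx P *m x i *m P); split.
- by move=> i; have := Hx i.
- move=> z; apply: x1; rewrite -z word_val_conj //.
  by rewrite !mulmxA mulmxK // mulmxV // mul1mx.
- move=> z; apply: x2; rewrite -mulNmx -mulmxN -z word_val_conj //.
  by rewrite !mulmxA mulmxK // mulmxV // mul1mx.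
Qed.

(** * Singular matrices orthogonal to the group under the trace form *)

Lemma row_parallel (v a : 'rV[F]_2) : v != 0 -> a 0 0 * v 0 1 = a 0 1 * v 0 0 ->
  exists l, a = l *: v.
Proof.
move=> /row_neq0P/orP[] vj e.
  exists (a 0 0 / v 0 0); apply/rowP => j; rewrite !mxE.
  case: (ord2P j) => ->; first by rewrite divfK.
  by rewrite mulrAC e mulfK.
exists (a 0 1 / v 0 1); apply/rowP => j; rewrite !mxE.
case: (ord2P j) => ->; last by rewrite divfK.
by rewrite mulrAC -e mulfK.
Qed.

(** Either row 0 is zero, or row 1 is a multiple of it. *)
Lemma rank1_factor (X : 'M[F]_2) : X != 0 -> \det X = 0 ->
  exists (u : 'I_2 -> F) (v : 'rV_2),
    [/\ v != 0, forall i j, X i j = u i * v 0 j & exists i, u i != 0].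
Proof.
move=> X0; rewrite det_mx22 => /eqP; rewrite subr_eq0 => /eqP dX.
have [r0|r0] := eqVneq (row 0 X) 0.
  have X0j j : X 0 j = 0 by move/rowP/(_ j): r0; rewrite !mxE.
  exists (fun i => if i == 0 then 0 else 1), (row 1 X); split.
  - apply: contra X0 => /eqP r1; apply/eqP/matrixP => i j.
    by case: (ord2P i) => ->; rewrite mxE ?X0j //; move/rowP/(_ j): r1; rewrite !mxE.
  - by move=> i j; case: (ord2P i) => -> /=; rewrite ?mul0r ?mul1r ?mxE.
  - by exists 1; rewrite /= oner_eq0.
have [|k e] := @row_parallel (row 0 X) (row 1 X) r0.
  by rewrite !mxE mulrC -dX mulrC.
exists (fun i => if i == 0 then 1 else k), (row 0 X); split => //.
  move=> i j; case: (ord2P i) => -> /=; first by rewrite mul1r mxE.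
  by move/rowP/(_ j): e; rewrite !mxE.
by exists 0; rewrite /= oner_eq0.
Qed.

Lemma mxtrace_mul22 (A B : 'M[F]_2) : \tr (A *m B) =
  A 0 0 * B 0 0 + A 0 1 * B 1 0 + (A 1 0 * B 0 1 + A 1 1 * B 1 1).
Proof.
rewrite /mxtrace !big_ord_recl big_ord0 addr0 -!mxE2; congr (_ + (A *m B) _ _);
by apply/val_inj.
Qed.

(* X = u v with u a column and v a row, so v g u = tr (X g) = 0 for all g, and
   also v u = 0; in dimension 2 this forces v g to be proportional to v. *)
Lemma singular_trace_orth (X : 'M[F]_2) : X != 0 -> \det X = 0 ->
  (forall g, G g -> \tr (X *m g) = 0) -> fixes_line.
Proof.
move=> X0 dX trX; have [u [v [v0 Xuv [i ui]]]] := rank1_factor X0 dX.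
exists v => // g Gg; apply: row_parallel => //.
have ug k : G k -> (v *m k) 0 0 * u 0 + (v *m k) 0 1 * u 1 = 0.
  by move/trX; rewrite mxtrace_mul22 !Xuv !mul_rV2E => <-; ring.
have := ug _ (sl2_group1 gG); rewrite mulmx1 => e1; have e2 := ug _ Gg.
apply/eqP; rewrite -subr_eq0.
suff : ((v *m g) 0 0 * v 0 1 - (v *m g) 0 1 * v 0 0) * u i == 0.
  by rewrite mulf_eq0 (negPf ui) orbF.
apply/eqP; case: (ord2P i) => ->.
  transitivity (v 0 1 * ((v *m g) 0 0 * u 0 + (v *m g) 0 1 * u 1) -
    (v *m g) 0 1 * (v 0 0 * u 0 + v 0 1 * u 1)); first by ring.
  by rewrite e1 e2 !mulr0 subr0.
transitivity ((v *m g) 0 0 * (v 0 0 * u 0 + v 0 1 * u 1) -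
   v 0 0 * ((v *m g) 0 0 * u 0 + (v *m g) 0 1 * u 1)); first by ring.
by rewrite e1 e2 !mulr0 subr0.
Qed.

End Dichotomy.

(** * Bounded orders of eigenvalues force finiteness *)

Section Finite.
Variables (F : closedFieldType) (G : 'M[F]_2 -> Prop).
Hypothesis gG : sl2_group G.

Lemma exists_eigenvalue (t : F) : exists2 l : F, l != 0 & t = l + l^-1.
Proof.
(* The coefficients encode l^2 = t l - 1. *)
have [l] := solve_monicpoly (fun i => if i == 0%N then -1 else t) (isT : 0 < 2)%N.
rewrite !big_ord_recl big_ord0 /= expr0 mulr1 addr0 /bump /= expr1 => e.
have l0 : l != 0.
  by apply/eqP => l0; move/eqP: e; rewrite l0 expr0n mulr0 addr0 /= eq_sym oppr_eq0 oner_eq0.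
exists l => //; apply: (mulIf l0); rewrite mulrDl mulVf //.
by rewrite -expr2 e addrAC addNr add0r.
Qed.

(* An invertible X can be replaced by the singular X (g - l), where l is an
   eigenvalue of a nonscalar g. *)
Lemma trace_orth (X : 'M[F]_2) : ~ fixes_line G ->
  (forall g, G g -> \tr (X *m g) = 0) -> X = 0.
Proof.
move=> irr trX; apply/eqP/negPn/negP => X0; apply: irr.
have [dX|dX] := eqVneq (\det X) 0; first exact: (singular_trace_orth gG X0 dX trX).
have uX : X \in unitmx by rewrite unitmxE unitfE.
case: (pselect (forall g, G g -> is_scalar_mx g)) => [sc|/existsNP[g /not_implyP[Gg gs]]].
  exists (row 0 1%:M).
    by apply/eqP => /rowP/(_ 0); rewrite !mxE /= => /eqP; rewrite oner_eq0.
  by move=> g /sc /is_scalar_mxP[l ->]; exists l; rewrite mul_mx_scalar.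
have [l l0 tg] := exists_eigenvalue (\tr g).
have [v v0 vg] := exists_eigenvector l0 (sl2_group_det gG Gg) tg.
have dgl : \det (g - l%:M) = 0.
  by apply/eqP/det0P; exists v; rewrite // mulmxBr vg mul_mx_scalar subrr.
apply: (@singular_trace_orth _ _ gG (X *m (g - l%:M))).
- apply/negP => /eqP z; apply: gs; apply/is_scalar_mxP; exists l.
  by apply/eqP; rewrite -subr_eq0 -(mulKmx uX (g - _)) z mulmx0.
- by rewrite det_mulmx dgl mulr0.
- move=> h Gh; rewrite mulmxBr mulmxBl linearB /= -mulmxA trX ?mul_mx_scalar.
    by rewrite -scalemxAl linearZ /= trX // mulr0 subr0.
  exact: sl2_groupM.
Qed.

(** Induction on the dimension of the space U of matrices still to be detected: by [trace_orth],
    some g in G has tr (X g) <> 0 for a nonzero X in U, and adding g to L cuts U down to a proper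
    subspace. *)
Lemma trace_orth_finite : ~ fixes_line G ->
  exists L : seq 'M[F]_2, (forall g, g \in L -> G g) /\
    forall X, (forall g, g \in L -> \tr (X *m g) = 0) -> X = 0.
Proof.
move=> irr.
suff main d (U : {vspace 'M[F]_2}) : (\dim U < d)%N -> exists L : seq 'M[F]_2,
    (forall g, g \in L -> G g) /\
    forall X, X \in U -> (forall g, g \in L -> \tr (X *m g) = 0) -> X = 0.
  have [L [LG LX]] := main _ fullv (ltnSn _).
  by exists L; split=> // X; apply: LX; rewrite memvf.
elim: d U => [//|d IH] U Ud.
have [U0|U0] := eqVneq U 0%VS.
  by exists [::]; split => // X; rewrite U0 memv0 => /eqP.
have : ~ forall g, G g -> \tr (vpick U *m g) = 0.
  by move/(trace_orth irr)/eqP; rewrite vpick0 (negPf U0).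
case/existsNP => g /not_implyP[Gg tg].
pose f : 'Hom('M[F]_2, F^o) := linfun ((@mxtrace F 2 : 'M[F]_2 -> F^o) \o mulmxr g).
have fE X : f X = \tr (X *m g) by rewrite lfunE.
have [|L [LG LX]] := IH (U :&: lker f)%VS.
  rewrite -ltnS (leq_trans _ Ud) // ltnS (leq_ltn_trans _ (_ : \dim (U :&: lker f) < \dim U)%N) //.
  rewrite ltn_neqAle dimvS ?capvSl // andbT; apply/eqP => e.
  have /eqP UU : (U :&: lker f)%VS == U by rewrite eqEdim capvSl e leqnn.
  apply: tg; rewrite -fE; have := memv_pick U.
  by rewrite -{2}UU memv_cap memv_ker => /andP[_ /eqP].
exists (g :: L); split=> [h|X XU XL]; first by rewrite inE => /orP[/eqP ->|/LG].
apply: LX => [|h hL]; last by apply: XL; rewrite inE hL orbT.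
by rewrite memv_cap XU memv_ker; apply/eqP; rewrite fE XL ?mem_head.
Qed.

(** An element A of G is determined by the traces of A g for g in L, and each of these is l + 1/l
    for a root l of X^k - 1. *)
Lemma finite_of_bounded_order k : (0 < k)%N -> ~ fixes_line G ->
    (forall g l, G g -> l != 0 -> \tr g = l + l^-1 -> l ^+ k = 1) ->
  exists (T : finType) (f : 'M[F]_2 -> T),
    forall A B, G A -> G B -> f A = f B -> A = B.
Proof.
move=> k0 irr gk; have [L [LG LX]] := trace_orth_finite irr.
have [r rE] := closed_field_poly_normal ('X^k - 1 : {poly F}).
pose S := [seq l + l^-1 | l <- r].
have GS g : G g -> \tr g \in S.
  move=> Gg; have [l l0 tg] := exists_eigenvalue (\tr g).
  rewrite tg; apply: map_f.
  have : root ('X^k - 1) l by rewrite rootE !hornerE (gk _ _ Gg l0 tg) subrr.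
  rewrite rE rootZ ?root_prod_XsubC // lead_coef_eq0 -size_poly_eq0.
  by rewrite -polyC1 size_XnsubC.
(* The additional value in ['I_(size S).+1] receives traces outside S, which do not occur for A in
   G. *)
exists {ffun 'I_(size L) -> 'I_(size S).+1}.
exists (fun A => [ffun i => inord (index (\tr (A *m tnth (in_tuple L) i)) S)]).
move=> A B GA GB /ffunP fAB; apply/eqP; rewrite -subr_eq0; apply/eqP.
apply: LX => g gL; rewrite mulmxBl linearB /=; apply/eqP; rewrite subr_eq0; apply/eqP.
have [i ->] : exists i, g = tnth (in_tuple L) i.
  by apply/tnthP.
have gi : G (tnth (in_tuple L) i) by apply: LG; rewrite mem_tnth.
have := fAB i; rewrite !ffunE => /(congr1 val) /=.
rewrite !inordK ?ltnS ?index_size // => e.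
rewrite -(nth_index 0 (GS _ (sl2_groupM gG GA gi))) e nth_index //.
exact: GS (sl2_groupM gG GB gi).
Qed.

End Finite.

(** * Virtually solvable groups *)

Section Groups.
Variable Gam : groupType.
Local Open Scope group_scope.

Lemma morphg1 (K : groupType) (f : Gam -> K) : {morph f : x y / x * y} -> f 1 = 1.
Proof. by move=> fM; apply: (mulgI (f 1)); rewrite -fM !mulg1. Qed.

Lemma morphgV (K : groupType) (f : Gam -> K) :
  {morph f : x y / x * y} -> forall x, f x^-1 = (f x)^-1.
Proof.
by move=> fM x; apply: (mulgI (f x)); rewrite -fM !mulgV morphg1.
Qed.

Lemma exists_groupClosed (S : set Gam) :
  S 1 -> (forall x y, S x -> S y -> S (x / y)) ->
  exists K : groupClosed Gam, forall x, (x \in K) = `[< S x >].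
Proof.
move=> S1 SF; pose p : {pred Gam} := fun x => `[< S x >].
have pg : group_closed p.
  by split=> [|x y /asboolP Sx /asboolP Sy]; apply/asboolP => //; exact: SF.
pose m1 := isMul1Closed.Build Gam p (proj1 pg).
pose m2 := isInvClosed.Build Gam p (group_closedV pg).
pose m3 := isMulClosed.Build Gam p (group_closedM pg).
pose K : groupClosed Gam := HB.pack p m1 m2 m3.
by exists K.
Qed.

Lemma finite_index_two (K : groupClosed Gam) :
  (forall x y, x \notin K -> y \notin K -> x^-1 * y \in K) -> finite_index K.
Proof.
move=> KK; pose co x := [set x * k | k in [set k | k \in K]]%classic.
have coE x y : x^-1 * y \in K -> co x = co y.
  move=> xy; apply/seteqP; split=> z [k /= Kk <-].
    exists (y^-1 * x * k); last by rewrite !mulgA mulgV mul1g.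
    by apply: gpredM => //; rewrite -gpredV invgM invgK.
  by exists (x^-1 * y * k); [exact: gpredM|rewrite !mulgA mulgV mul1g].
rewrite /finite_index -/co.
have [[y yK]|no] := pselect (exists y, y \notin K).
  apply: (@sub_finite_set _ _ [set co 1; co y]); last exact: finite_set2.
  move=> _ [x _ <-] /=; case: (boolP (x \in K)) => xK; [left|right]; apply: coE.
    by rewrite mulg1 gpredV.
  exact: KK.
apply: (@sub_finite_set _ _ [set co 1]); last exact: finite_set1.
move=> _ [x _ <-] /=; apply: coE; rewrite mulg1 gpredV.
by apply/negPn/negP => xK; apply: no; exists x.
Qed.

Lemma generated_subgroup_sub (A S : set Gam) :
  S 1 -> (forall x y, S x -> S y -> S (x / y)) -> (A `<=` S)%classic ->
  (generated_subgroup A `<=` S)%classic.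
Proof.
move=> S1 SF AS; apply: smallest_sub => //.
split=> [|x y]; first exact/mem_set.
by move=> /set_mem Sx /set_mem Sy; apply/mem_set/SF.
Qed.

Lemma generated_subgroup1 (A : set Gam) : generated_subgroup A 1.
Proof. by move=> S [[/set_mem]]. Qed.

(** The trivial subgroup of a finite group has finite index, and its derived series is trivial from
    term 0 on. *)
Lemma finite_virtually_solvable (T : finType) (f : Gam -> T) :
  injective f -> virtually_solvable Gam.
Proof.
move=> fI; have [||K KE] := @exists_groupClosed [set 1%g].
- by [].
- by move=> x y -> ->; rewrite /= mulgV.
exists K.
  apply: finite_image; apply: (@finite_preimage _ _ [set: T] f); last exact: finite_finset.
  by move=> x y _ _; exact: fI.
exists 0%N; apply/seteqP; split => // x _ /=.
by apply/val_inj; rewrite val1; have := valP x; rewrite KE => /asboolP.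
Qed.

End Groups.

(** * Representations up to sign *)

Definition eq_upto_sign (V : zmodType) (A B : V) := A = B \/ A = - B.

(* f lifts an embedding of Gam into PSL_2, whence the equalities up to sign. *)
Record proj_rep (F : fieldType) (Gam : groupType) (f : Gam -> 'M[F]_2) : Prop :=
  ProjRep {
    proj_rep_det : forall x, \det (f x) = 1;
    proj_repM : forall x y, eq_upto_sign (f (x * y)%g) (f x *m f y);
    proj_rep_inj : forall x, eq_upto_sign (f x) 1%:M -> x = 1%g }.

Section UpToSign.
Variable F : fieldType.
Implicit Types A B C : 'M[F]_2.

Lemma eq_sign_refl A : eq_upto_sign A A. Proof. by left. Qed.

Lemma eq_sign_sym A B : eq_upto_sign A B -> eq_upto_sign B A.
Proof. by case=> ->; [left|right; rewrite opprK]. Qed.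

Lemma eq_sign_trans A B C : eq_upto_sign A B -> eq_upto_sign B C -> eq_upto_sign A C.
Proof. by case=> -> [] ->; rewrite ?opprK; [left|right|right|left]. Qed.

Lemma eq_sign_mul A A' B B' : eq_upto_sign A A' -> eq_upto_sign B B' ->
  eq_upto_sign (A *m B) (A' *m B').
Proof.
by case=> -> [] ->; rewrite ?mulmxN ?mulNmx ?opprK; [left|right|right|left].
Qed.

Lemma oppmxE A i j : (- A) i j = - A i j. Proof. by rewrite mxE. Qed.

Lemma invmxN A : A \in unitmx -> invmx (- A) = - invmx A.
Proof.
by move=> uA; rewrite -scaleN1r invmxZ ?invrN1 ?scaleN1r // -scaleN1r unitmxZ ?unitrN1.
Qed.

Lemma det_mx22N A : \det (- A) = \det A.
Proof. by rewrite !det_mx22 !mxE; ring. Qed.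

Lemma sign_scalar A : \det A = 1 -> is_scalar_mx A -> eq_upto_sign A 1%:M.
Proof.
move=> dA /is_scalar_mxP[a aA]; move/eqP: dA; rewrite aA det_scalar.
by rewrite -subr_eq0 subr_sqr_1 mulf_eq0 subr_eq0 addr_eq0 => /orP[] /eqP ->;
  [left|right; rewrite raddfN].
Qed.

End UpToSign.

Section ProjRep.
Variables (F : fieldType) (Gam : groupType) (f : Gam -> 'M[F]_2).
Hypothesis fR : proj_rep f.

Let fM := proj_repM fR.
Let fdet := proj_rep_det fR.
Let fu x : f x \in unitmx. Proof. exact/det1_unitmx/fdet. Qed.

Lemma proj_rep1 : eq_upto_sign (f 1%g) 1%:M.
Proof.
have := fM 1%g 1%g; rewrite mulg1 => -[] e; [left|right].
  by rewrite -(mulKmx (fu 1%g) (f 1%g)) -e mulVmx.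
by rewrite -(mulKmx (fu 1%g) (f 1%g)) -[f _ *m f _]opprK -e mulmxN mulVmx.
Qed.

Lemma proj_repV x : eq_upto_sign (f x^-1%g) (invmx (f x)).
Proof.
have := eq_sign_trans (eq_sign_sym (fM x x^-1%g)) (_ : eq_upto_sign _ 1%:M).
rewrite mulgV => /(_ proj_rep1)[] e; [left|right].
  by rewrite -(mulKmx (fu x) (f x^-1%g)) e mulmx1.
by rewrite -(mulKmx (fu x) (f x^-1%g)) e mulmxN mulmx1.
Qed.

Lemma proj_rep_injective x y : eq_upto_sign (f x) (f y) -> x = y.
Proof.
move=> fxy; apply: (mulIg y^-1%g); rewrite mulgV; apply: (proj_rep_inj fR).
apply: eq_sign_trans (fM _ _) _.
apply: eq_sign_trans (eq_sign_mul fxy (proj_repV y)) _.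
by rewrite mulmxV //; left.
Qed.

Lemma proj_rep_conj P : P \in unitmx -> proj_rep (fun x => P *m f x *m invmx P).
Proof.
move=> uP; split=> [x|x y|x].
- by rewrite det_conj.
- rewrite conj_mulmx //.
  by case: (fM x y) => ->; [left|right; rewrite mulmxN mulNmx].
- move=> e; apply: (proj_rep_inj fR).
  have -> : f x = invmx P *m (P *m f x *m invmx P) *m P.
    by rewrite !mulmxA mulVmx // mul1mx mulmxKV.
  case: e => ->; [left|right].
    by rewrite mulmx1 mulVmx.
  by rewrite mulmxN mulmx1 mulNmx mulVmx.
Qed.

(** The full preimage in SL_2: closing under sign turns the range of f, which is multiplicative only
    up to sign, into a group. *)
Definition proj_image A := exists x, eq_upto_sign A (f x).

Lemma sl2_group_proj_image : sl2_group proj_image.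
Proof.
split=> [|A B [x Ax] [y By]|A [x Ax]|A [x [] ->]].
- by exists 1%g; exact/eq_sign_sym/proj_rep1.
- exists (x * y)%g; apply: eq_sign_trans (eq_sign_mul Ax By) _.
  exact: eq_sign_sym.
- exists x^-1%g; apply: eq_sign_trans _ (eq_sign_sym (proj_repV x)).
  by case: Ax => ->; rewrite ?invmxN //; [left|right].
- exact: fdet.
- by rewrite det_mx22N.
Qed.

(** Squaring the diagonal entry removes the sign, so chi is a homomorphism to the multiplicative
    group and kills commutators. On its kernel both diagonal entries agree, and lower triangular
    matrices of this kind commute; hence derived length at most 2. *)
Lemma triangular_solvable : (forall x, f x 0 1 = 0) -> solvable_group Gam.
Proof.
move=> f01; pose chi x := (f x 0 0) ^+ 2.
have chiM x y : chi (x * y)%g = chi x * chi y.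
  rewrite /chi; case: (fM x y) => ->; rewrite ?oppmxE mxE2 f01 mul0r addr0; ring.
have chi0 x : chi x != 0.
  rewrite expf_neq0 //; apply/eqP => z; have := oner_neq0 F.
  by rewrite -(fdet x) det_mx22 f01 z !mul0r subr0 eqxx.
have chi1 : chi 1%g = 1 by apply: (mulfI (chi0 1%g)); rewrite -chiM mulg1 mulr1.
have chiV x : chi x^-1%g = (chi x)^-1.
  by apply: (mulfI (chi0 x)); rewrite -chiM mulgV chi1 mulfV.
have der1 : (@derived_series Gam 1 `<=` [set x | chi x = 1%R])%classic.
  apply: generated_subgroup_sub => //= [x y cx cy|_ [x _ [y _ <-]]] /=.
    by rewrite chiM chiV cx cy invr1 mulr1.
  rewrite commgEl conjgE !chiM !chiV.
  by field; rewrite !chi0.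
exists 2; apply/seteqP; split=> [|_ ->]; last exact: generated_subgroup1.
apply: generated_subgroup_sub => //= [x y -> ->|_ [x /der1 cx [y /der1 cy <-]]].
  by rewrite mulgV.
apply/eqP/commgP; apply: proj_rep_injective.
apply: eq_sign_trans (fM _ _) _; apply: eq_sign_trans _ (eq_sign_sym (fM _ _)); left.
have diag z : chi z = 1 -> f z 1 1 = f z 0 0.
  move=> cz; have := fdet z; rewrite det_mx22 f01 mul0r subr0 => e.
  have z0 : f z 0 0 != 0 by have := chi0 z; rewrite expf_eq0.
  by apply: (mulfI z0); rewrite e -cz /chi expr2.
by apply: eq_mx22; rewrite !mxE2 ?f01 ?(diag x cx) ?(diag y cy); ring.
Qed.

End ProjRep.

Lemma proj_rep_val (F : fieldType) (Gam : groupType) (f : Gam -> 'M[F]_2)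
  (K : groupClosed Gam) : proj_rep f -> proj_rep (fun x : subgroup K => f (val x)).
Proof.
move=> fR; split=> [x|x y|x /(proj_rep_inj fR) x1].
- exact: proj_rep_det fR _.
- exact: proj_repM fR _ _.
- by apply/val_inj; rewrite x1 val1.
Qed.

(** * Groups preserving a line or a pair of lines *)

Section VirtuallySolvable.
Variables (F : fieldType) (Gam : groupType) (f : Gam -> 'M[F]_2).
Hypothesis fR : proj_rep f.

(** The elements with diagonal image form a subgroup, of index at most 2 since a product of two
    antidiagonal matrices is diagonal. *)
Lemma monomial_virtually_solvable : (forall x, monomial (f x)) -> virtually_solvable Gam.
Proof.
move=> mon; pose S := [set x : Gam | f x 0 1 = 0 /\ f x 1 0 = 0]%classic.
have fV x : [/\ eq_upto_sign (f x^-1%g 0 0) (f x 1 1), eq_upto_sign (f x^-1%g 0 1) (f x 0 1),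
    eq_upto_sign (f x^-1%g 1 0) (f x 1 0) & eq_upto_sign (f x^-1%g 1 1) (f x 0 0)].
  have [i1 i2 i3 i4] := invmx22 (proj_rep_det fR x).
  case: (proj_repV fR x) => ->; rewrite ?oppmxE i1 i2 i3 i4 ?opprK;
    by split; try (by left); right.
have sign0 (a b : F) : eq_upto_sign a b -> b = 0 -> a = 0.
  by case=> -> ->; rewrite ?oppr0.
have SF x y : S x -> S y -> S (x / y)%g.
  move=> [x01 x10] [y01 y10]; have [_ e2 e3 _] := fV y.
  by split; case: (proj_repM fR x y^-1%g) => ->; rewrite ?oppmxE mxE2 ?x01 ?x10 ?(sign0 _ _ e2 y01)
   ?(sign0 _ _ e3 y10) !(mul0r, mulr0, addr0, oppr0).
have [|//|K KE] := @exists_groupClosed Gam S.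
  by split; case: (proj_rep1 fR) => ->; rewrite !mxE ?oppr0.
exists K.
  apply: finite_index_two => x y; rewrite !KE => /asboolP xK /asboolP yK; apply/asboolP.
  have anti z : ~ S z -> f z 0 0 = 0 /\ f z 1 1 = 0.
    move=> zK; have /orP[] := mon z => /andP[/eqP z1 /eqP z2] //.
    by case: zK.
  have [x00 x11] := anti _ xK; have [y00 y11] := anti _ yK.
  have [e1 _ _ e4] := fV x.
  split; case: (proj_repM fR x^-1%g y) => ->; rewrite ?oppmxE mxE2 ?y00 ?y11 ?(sign0 _ _ e1 x11)
   ?(sign0 _ _ e4 x00) !(mul0r, mulr0, addr0, oppr0) //.
apply: (triangular_solvable (proj_rep_val K fR)) => x.
by have := valP x; rewrite KE => /asboolP[].
Qed.

(** Completing v to a basis makes f lower triangular; the whole group then serves as the subgroup of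
    finite index. *)
Lemma reducible_virtually_solvable :
  fixes_line (proj_image f) -> virtually_solvable Gam.
Proof.
move=> [v v0 vP].
have [u uP] : exists u : 'rV[F]_2, v 0 0 * u 0 1 - v 0 1 * u 0 0 != 0.
  case/orP: (row_neq0P v0) => vj.
    by exists (\row_j (if j == 1 then 1 else 0)); rewrite !mxE /= mulr0 mulr1 subr0.
  by exists (\row_j (if j == 0 then 1 else 0)); rewrite !mxE /= mulr0 mulr1 sub0r oppr_eq0.
pose P : 'M[F]_2 := \matrix_(i, j) if i == 0 then v 0 j else u 0 j.
have uPm : P \in unitmx by rewrite unitmxE unitfE det_mx22 !mxE.
have rP : row 0 P = v by apply/rowP => j; rewrite !mxE.
have fR' := proj_rep_conj fR uPm.
have f01 x : (P *m f x *m invmx P) 0 1 = 0.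
  have [l vl] : exists l, v *m f x = l *: v by apply: vP; exists x; left.
  have : row 0 (P *m f x *m invmx P) = l *: row 0 1%:M.
    by rewrite -(mulmxV uPm) !row_mul rP vl scalemxAl.
  by move: (P *m f x *m invmx P) => Q /rowP/(_ 1); rewrite !mxE mulr0.
have [||K KE] := @exists_groupClosed Gam setT => //.
exists K; last exact: (triangular_solvable (proj_rep_val K fR')) => x.
by apply: finite_index_two => x y; rewrite KE => /asboolP[].
Qed.

End VirtuallySolvable.

(** * Mixed identities *)

Section NormalForm.
Variables (Gam : groupType) (n : nat).
Local Open Scope group_scope.
Local Notation FP := (free_prod Gam (free_group 'I_n)).
Local Open Scope quotient_scope.
Implicit Types (w : seq ('I_n * bool * Gam)).

(** The map c carries the constants into K, so that one word can be evaluated both in the free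
    product and in Gam. *)
Fixpoint word_gval (K : groupType) (c : Gam -> K) (x : 'I_n -> K) w : K :=
  if w is (i, s, g) :: w' then
    (if s then (x i)^-1 else x i) * c g * word_gval c x w'
  else 1.

Lemma morph_word_gval (K K' : groupType) (c : Gam -> K) (x : 'I_n -> K) (phi : K -> K') w :
  {morph phi : a b / a * b} ->
  phi (word_gval c x w) = word_gval (phi \o c) (phi \o x) w.
Proof.
move=> phiM; elim: w => [|[[i s] g] w IH] /=; first exact: morphg1.
by rewrite !phiM IH; case: s; rewrite ?morphgV.
Qed.

Let inlF : Gam -> FP := @free_prod_inl _ _.
Let inrF : free_group 'I_n -> FP := @free_prod_inr _ _.
Let inlM : {morph inlF : a b / a * b}. Proof. exact: free_prod_inlM. Qed.
Let inrM : {morph inrF : a b / a * b}. Proof. exact: free_prod_inrM. Qed.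

(** Each letter carries the constant on its right, whence a separate constant c in front. *)
Definition has_reduced_form (p : FP) := exists c w,
  reduced (pred1 1) w /\ p = inlF c * word_gval inlF (inrF \o @free_gen _) w.

Lemma reduced_form_inl a p : has_reduced_form p -> has_reduced_form (inlF a * p).
Proof.
by move=> [c [w [red ->]]]; exists (a * c), w; rewrite inlM mulgA.
Qed.

(** The new letter takes over the front constant c. If this breaks reducedness, then c = 1 and the
    new letter is inverse to the first one; both cancel, and the next constant d moves to the
    front. *)
Lemma reduced_form_gen i s p : has_reduced_form p ->
  has_reduced_form ((if s then (inrF (free_gen i))^-1 else inrF (free_gen i)) * p).
Proof.
move=> [c [w [red ->]]].
have cons_form : reduced (pred1 1) ((i, s, c) :: w) -> has_reduced_form
  ((if s then (inrF (free_gen i))^-1 else inrF (free_gen i)) *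
   (inlF c * word_gval inlF (inrF \o @free_gen _) w)).
  by move=> red'; exists 1, ((i, s, c) :: w); rewrite morphg1 // mul1g /= mulgA.
case: w red cons_form => [|[[j s'] d] w] red cons_form; first exact: cons_form.
have [ok|] := boolP (((c == 1) && (i == j)) ==> (s == s')).
  by apply: cons_form => /=; rewrite ok.
rewrite negb_imply => /andP[/andP[/eqP -> /eqP ->] ss].
exists d, w; split; first by case/andP: red.
rewrite morphg1 // mul1g /= !mulgA.
by case: s s' ss {red cons_form} => [] [] //= _; rewrite ?mulgV ?mulVg mul1g.
Qed.

Lemma reduced_form_inr q p : has_reduced_form p -> has_reduced_form (inrF q * p).
Proof.
move=> rp; rewrite -[q]reprK; elim: (repr q) => [|[i s] v IH].
  rewrite (_ : \pi [::] = 1 :> free_group 'I_n) //.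
  by rewrite morphg1 // mul1g.
have -> : \pi_(free_group 'I_n) ((i, s) :: v) =
    (if s then (free_gen i)^-1 else free_gen i) * \pi v.
  rewrite !pres_gen_word /word_eval big_cons; by case: s.
rewrite inrM -mulgA; have := reduced_form_gen i s IH.
by case: s => //; rewrite morphgV.
Qed.

Lemma exists_reduced_form p : has_reduced_form p.
Proof.
rewrite -[p]reprK; elim: (repr p) => [|[x b] v IH].
  by exists 1, [::]; split => //; rewrite mulg1 morphg1.
have -> : \pi_FP ((x, b) :: v) =
    (if b then (pres_gen _ x)^-1 else pres_gen _ x) * \pi v.
  rewrite !pres_gen_word /word_eval big_cons; by case: b.
case: x => [a|q].
  have := reduced_form_inl (if b then a^-1 else a) IH.
  by case: b => //; rewrite morphgV.
have := reduced_form_inr (if b then q^-1 else q) IH.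
by case: b => //; rewrite morphgV.
Qed.

End NormalForm.

(** * The dichotomy *)

Section Main.
Variables (F : closedFieldType) (Gam : groupType) (f : Gam -> 'M[F]_2).
Hypothesis fR : proj_rep f.

(** Signs are central, so those arising at the letters collect into one. *)
Lemma proj_rep_word n (y : 'I_n -> Gam) (x : nat -> 'M[F]_2)
    (w : seq ('I_n * bool * Gam)) :
  (forall i : 'I_n, eq_upto_sign (x i) (f (y i))) ->
  eq_upto_sign (word_val x [seq (nat_of_ord u.1.1, u.1.2, f u.2) | u <- w])
    (f (word_gval id y w)).
Proof.
move=> xy; elim: w => [|[[i s] g] w IH] /=.
  exact/eq_sign_sym/(proj_rep1 fR).
apply: eq_sign_trans _ (eq_sign_sym (proj_repM fR _ _)).
apply: eq_sign_mul => //.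
apply: eq_sign_trans _ (eq_sign_sym (proj_repM fR _ _)).
apply: eq_sign_mul; last by left.
case: s => //; apply: eq_sign_trans _ (eq_sign_sym (proj_repV fR _)).
have uf := det1_unitmx (proj_rep_det fR (y i)).
by case: (xy i) => ->; rewrite ?invmxN //; [left|right].
Qed.

Theorem proj_rep_dichotomy : virtually_solvable Gam \/ mixed_identity_free Gam.
Proof.
have gG := sl2_group_proj_image fR.
have [red|irr] := pselect (fixes_line (proj_image f)).
  by left; exact: (reducible_virtually_solvable fR).
have [[P uP mon]|prim] := pselect (exists2 P, P \in unitmx &
    forall g, proj_image f g -> monomial (P *m g *m invmx P)).
  left; apply: (monomial_virtually_solvable (proj_rep_conj fR uP)) => x.
  by apply: mon; exists x; left.
have [[k [k0 bdd]]|unb] := pselect (exists k, (0 < k)%N /\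
    forall g l, proj_image f g -> l != 0 -> \tr g = l + l^-1 -> l ^+ k = 1).
  left; have [T [h hI]] := finite_of_bounded_order gG k0 irr bdd.
  apply: (@finite_virtually_solvable _ T (h \o f)) => x y /= e.
  apply: (proj_rep_injective fR); left; apply: hI e; by [exists x; left|exists y; left].
right=> n w wid.
have [c [u [red wE]]] := exists_reduced_form w.
(* The universal properties extend y to a homomorphism that is the identity on Gam, so the mixed
   identity gives c u(y) = 1 for every y. *)
have subst (y : 'I_n -> Gam) : (c * word_gval id y u)%g = 1%g.
  have [phi2 phi2E] := (free_group_universal y).1.
  pose idm : UMagmaMorphism.type Gam Gam := idfun.
  have [phi [phil phir]] := (free_prod_universal idm phi2).1.
  have := wid phi phil; rewrite wE gmulfM phil.
  rewrite morph_word_gval => [<-|]; last exact: gmulfM.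
  congr (_ * _)%g; elim: (u) => [|[[i s] g] u' IH] //=.
  by rewrite -IH phil phir phi2E.
have [u0|u0] := eqVneq u [::].
  rewrite wE u0 /= mulg1; have := subst (fun=> 1%g).
  by rewrite u0 /= mulg1 => ->; apply: morphg1; exact: free_prod_inlM.
(* A value of u different from [invmx (f c)] and its negative contradicts c u(y) = 1. *)
have [||||x [Gx x1 x2]] := @word_val_neq_of_unbounded _ _ gG n
  [seq (nat_of_ord v.1.1, v.1.2, f v.2) | v <- u] (invmx (f c)) irr prim.
- move=> k k0; apply: contrapT => no; apply: unb; exists k; split=> // g l Gg l0 tg.
  by apply/eqP/negPn/negP => lk; apply: no; exists g, l.
- by rewrite -size_eq0 size_map size_eq0.
- apply: (@sub_reduced _ _ _ _ (@nat_of_ord n) f _ _ _ _ _ red); first exact: val_inj.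
  (* A scalar matrix of determinant 1 is 1 or -1, so [f g] is scalar only for g = 1. *)
  move=> g gs; apply/eqP/(proj_rep_inj fR)/sign_scalar => //.
  exact: proj_rep_det fR _.
- by move=> i s g /mapP[[[i' s'] g'] _ [-> _ ->]]; split=> //; exact: proj_rep_det fR _.
have [y yP] := choice Gx.
have := proj_rep_word u (fun i : 'I_n => yP i); set V := word_val _ _ => Vy.
have fc := det1_unitmx (proj_rep_det fR c).
have cV : eq_upto_sign (f c *m V) 1%:M.
  apply: eq_sign_trans (eq_sign_mul (eq_sign_refl _) Vy) _.
  apply: eq_sign_trans (eq_sign_sym (proj_repM fR _ _)) _.
  by rewrite subst; exact: proj_rep1 fR.
case: cV => e; [case: x1|case: x2].
  by rewrite -/V -(mulKmx fc V) e mulmx1.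
by rewrite -/V -(mulKmx fc V) e mulmxN mulmx1.
Qed.

End Main.

(** * Lifting PSL_2 to SL_2 *)

Lemma proj_rep_PSL2 (F : fieldType) : proj_rep (fun p : PSL2 F => val (repr p)).
Proof.
split=> [p|p q|p].
- exact: (eqP (valP (repr p))).
- exact: PSL2_reprP.
- move=> e; rewrite -[p]reprK; apply/eqP; rewrite eqmodE; apply/orP.
  by case: e => e; [left|right]; apply/eqP.
Qed.

Theorem corollary1p6 (R : realType) (H : groupClosed (PSL2 R[i])) :
  virtually_solvable (subgroup H) \/ mixed_identity_free (subgroup H).
Proof. exact: proj_rep_dichotomy (proj_rep_val H (@proj_rep_PSL2 _)). Qed.
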